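(* Let $\mathfrak g=\mathbb R e_7\ltimes\mathbb R^6$ be the $7$-dimensional almost Abelian (solvable) real Lie algebra with basis $e_1,\dots,e_7$ and dual basis $e^1,\dots,e^7$ satisfying the structure equations $$de^1=e^{67},\quad de^6=e^{17},\quad de^3=e^{47},\quad de^4=e^{37},\quad de^2=de^5=de^7=0,$$ and let $G$ be the $1$-connected Lie group with Lie algebra $\mathfrak g$, oriented by $e^{1234567}$. Consider the left-invariant $\mathrm G_2$-structure $$\varphi=e^{167}+e^{257}+e^{347}+e^{135}-e^{124}-e^{236}-e^{456},$$ with dual $4$-form $$\psi=\ast_\varphi\varphi=e^{1256}+e^{1346}+e^{2345}+e^{1237}+e^{1457}+e^{3567}-e^{2467}.$$ Then: (1) $d\psi=0$ and $\Delta_\psi\psi=4(e^{1457}+e^{3567})$. (2) $D=\operatorname{diag}(2,4,2,2,0,2,0)$ (in the basis $e_1,\dots,e_7$) is a derivation of $\mathfrak g$, and $\psi$ satisfies the soliton equation $$-\Delta_\psi\psi=\mathcal L_{X_D}\psi+\lambda\psi,\qquad \lambda=-8.$$ Moreover $\Delta_\psi\psi=\theta(Q_\psi)\psi$ with $Q_\psi=D+\tfrac{\lambda}{4}I_7=D-2I_7$. (3) For $t<\tfrac14$ put $c(t)=(1-4t)^2$, $s(t)=\tfrac14\log(1-4t)$ and $f(t)=\exp(s(t)D)$. Then $$\psi_t:=c(t)\,(f(t)^{-1})^\ast\psi=e^{1256}+e^{1346}+e^{2345}+e^{1237}+(1-4t)(e^{1457}+e^{3567})-e^{2467},$$ and $\{\psi_t\}_{t<1/4}$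 is a self-similar solution of the Laplacian co-flow with $\psi_0=\psi$, that is, $$\frac{d\psi_t}{dt}=-4(e^{1457}+e^{3567})=-\Delta_{\psi_t}\psi_t .$$
   Context: Notation: $e^{ij\cdots k}=e^i\wedge e^j\wedge\cdots\wedge e^k$. Left-invariant forms on $G$ are identified with elements of $\Lambda^\bullet\mathfrak g^\ast$, on which $d$ is the Chevalley–Eilenberg differential. The structure equations correspond to $[e_7,e_i]=Ae_i$ for $i\le 6$, where $Ae_1=e_6$, $Ae_6=e_1$, $Ae_3=e_4$, $Ae_4=e_3$, $Ae_2=Ae_5=0$, and the $e_i$ with $i\le6$ commute. A $\mathrm G_2$-structure on an oriented $7$-manifold is a positive $3$-form $\varphi$ (pointwise equivalent, under oriented linear isomorphisms, to the standard $\mathrm G_2$ $3$-form on $\mathbb R^7$). It determines a metric $g_\varphi$ by $6\,g_\varphi(X,Y)\operatorname{vol}_\varphi=(X\lrcorner\varphi)\wedge(Y\lrcorner\varphi)\wedge\varphi$, a Hodge star $\ast_\varphi$, and the dual $4$-form $\psi=\ast_\varphi\varphi$. Conversely, with the orientation fixed, $\psi$ determines $\varphi$, hence the metric and Hodge star. For the $\varphi$ above, $e_1,\dots,e_7$ is orthonormal. $\Delta_\psi=dd^\ast+d^\ast d$ is the Hodge Laplacian of the metric determined by $\psi$. The Laplacian co-flow is $\frac{\partial}{\partial t}\psi_t=-\Delta_{\psi_t}\psi_t$ for a family of $4$-forms $\psi_t$ dual to $\mathrm G_2$-structures. A solution is self-similar if $\psi_t=b_tf_t^\ast\psi$ for some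 nonvanishing scalars $b_t$ and diffeomorphisms $f_t$ of $G$. A linear automorphism of the Lie algebra $\mathfrak g$ acts by pullback on $\Lambda^\bullet\mathfrak g^\ast$, which corresponds to pullback of left-invariant forms by the automorphism of $G$ that it integrates to. For a derivation $D$ of $\mathfrak g$, $X_D$ is the vector field on $G$ whose flow is the one-parameter group of automorphisms of $G$ with differential $e^{tD}$ at the identity. For left-invariant $\psi$, $\mathcal L_{X_D}\psi=\frac{d}{dt}\big|_{t=0}(e^{tD})^\ast\psi$. For $B\in\mathfrak{gl}(\mathfrak g)$, $\theta(B)\psi=\frac{d}{dt}\big|_{t=0}(e^{-tB})^\ast\psi$. *)

(* Defs.v *)
From HB Require Import structures.
From mathcomp Require Import all_boot all_order all_algebra.
From mathcomp Require Import all_classical all_reals all_analysis.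
From mathcomp Require Import ring lra.

Set Implicit Arguments.
Unset Strict Implicit.
Unset Printing Implicit Defensive.

Import Order.TTheory GRing.Theory Num.Theory.
Import numFieldNormedType.Exports.

Local Open Scope ring_scope.

(* Vectors are rows and a linear map M acts by v |-> v *m M: row i of M holds
   the coordinates of the image of the i-th basis vector. *)

(* The exterior algebra of the dual of R^n: a S is the coefficient of a on
   e^S := e^(i_1) /\ ... /\ e^(i_k), where S = {i_1 < ... < i_k}. *)
Definition extform (R : realType) (n : nat) := {ffun {set 'I_n} -> R^o}.

Section ExteriorAlgebra.
Context {R : realType} {n : nat}.
Implicit Types (a b : extform R n) (S T U : {set 'I_n}) (M g : 'M[R]_n).

Definition ext_one : extform R n := [ffun S => (S == finset.set0)%:R].

Definition cov (k : 'I_n) : extform R n := [ffun S => (S == [set k])%:R].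

Definition inversions S T : nat :=
  #|[set p : 'I_n * 'I_n | [&& p.1 \in S, p.2 \in T & (p.2 < p.1)%N]]|.

(* For disjoint S and T, e^S /\ e^T = (-1)^(inversions S T) e^(S U T). *)
Definition wedge a b : extform R n :=
  [ffun U => \sum_(S in powerset U)
     (-1) ^+ inversions S (U :\: S) * (a S * b (U :\: S))].

(* Contraction with the k-th basis vector: for k in S,
   e_k _| e^S = (-1)^#{j in S | j < k} e^(S \ k). *)
Definition contract_basis (k : 'I_n) a : extform R n :=
  [ffun U : {set 'I_n} => if k \in U then 0
             else (-1) ^+ #|[set j in U | (j < k)%N]| * a (k |: U)].

Definition interior_prod (v : 'rV[R]_n) a : extform R n :=
  \sum_(k < n) v 0 k *: contract_basis k a.

(* M^* as an algebra morphism: M^* e^k = \sum_j M j k e^j, and the product over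
   S is taken in increasing order. *)
Definition pull M a : extform R n :=
  \sum_(S : {set 'I_n})
     a S *: \big[wedge/ext_one]_(k in S) (\sum_(j < n) M j k *: cov j).

(* A metric is given by its Gram matrix g in the basis (e_i). On forms,
   <e^S, e^T> is the minor of g^-1 on rows S and columns T, which is the
   coefficient of (g^-1)^* e^T on e^S. *)
Definition form_inner g a b : R :=
  \sum_(S : {set 'I_n}) a S * pull (invmx g) b S.

(* The volume form of g for the orientation e^(1...n). *)
Definition vol g : extform R n := [ffun S => Num.sqrt (\det g) * (S == finset.setT)%:R].

(* See hodgeP below for the defining property. *)
Definition hodge g b : extform R n :=
  [ffun U => Num.sqrt (\det g) *
     ((-1) ^+ inversions (~: U) U * pull (invmx g) b (~: U))].

Lemma hodgeP g a b :
  wedge a (hodge g b) finset.setT = (form_inner g a b *: vol g) finset.setT.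
Proof.
rewrite /wedge /vol /form_inner !ffunE eqxx mulr1 /GRing.scale /= mulr_suml.
rewrite powersetT.
apply: eq_big => [S|S _]; first by rewrite inE.
rewrite finset.setTD ffunE finset.setCK; set i := inversions _ _.
have s1 : (-1 : R) ^+ i * (-1) ^+ i = 1 by rewrite -exprD addnn -signr_odd odd_double.
set p := pull _ _ _; set q := Num.sqrt _.
transitivity (((-1 : R) ^+ i * (-1) ^+ i) * (a S * p * q)); first by ring.
by rewrite s1 mul1r.
Qed.

(* The Chevalley-Eilenberg differential of the bracket br:
   (d e^k)(x, y) = - e^k [x, y], extended as an antiderivation through
   d e^S = \sum_k d e^k /\ (e_k _| e^S). *)
Section Differential.
Variable br : 'rV[R]_n -> 'rV[R]_n -> 'rV[R]_n.

Definition dcov (k : 'I_n) : extform R n :=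
  - \sum_(i < n) \sum_(j < n | (i < j)%N)
      br (delta_mx 0 i) (delta_mx 0 j) 0 k *: wedge (cov i) (cov j).

Definition CE_d a : extform R n :=
  \sum_(k < n) wedge (dcov k) (contract_basis k a).

(* d^* = (-1)^(n(k+1)+1) * d * on k-forms. *)
Definition codiff g a : extform R n :=
  hodge g (CE_d (hodge g [ffun S : {set 'I_n} => (-1) ^+ (n * #|S|.+1).+1 * a S])).

Definition laplacian g a : extform R n :=
  CE_d (codiff g a) + codiff g (CE_d a).

Definition is_derivation (D : 'M[R]_n) : Prop :=
  forall x y, br x y *m D = br (x *m D) y + br x (y *m D).

End Differential.

Definition expM M : 'M[R]_n :=
  \matrix_(i, j) limn (series (fun k => iter k (mulmx M) 1%:M i j / k`!%:R)).

(* Derivatives of curves of forms are taken coefficientwise. *)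
Definition form_derive (w : R -> extform R n) (t : R) : extform R n :=
  [ffun S => derive1 (fun u : R => w u S : R^o) t].

Definition form_is_derive (w : R -> extform R n) (t : R) (dw : extform R n) : Prop :=
  forall S, is_derive t (1 : R) (fun u : R => w u S : R^o) (dw S).

(* L_(X_D) on left-invariant forms. *)
Definition lie_derivative (D : 'M[R]_n) a : extform R n :=
  form_derive (fun t => pull (expM (t *: D)) a) 0.

Definition theta (B : 'M[R]_n) a : extform R n :=
  form_derive (fun t => pull (expM (- t *: B)) a) 0.

End ExteriorAlgebra.

(* The monomial e^(i_1) /\ ... /\ e^(i_k), with indices counted from 1. *)
Definition e {R : realType} (s : seq nat) : extform R 7 :=
  \big[wedge/ext_one]_(i <- s) cov (inord i.-1).

Section G2.
Context {R : realType}.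
Implicit Types (phi psi : extform R 7) (g : 'M[R]_7).

(* The model form in the convention for which
   6 <x, y> e^(1...7) = (x _| phi) /\ (y _| phi) /\ phi. *)
Definition phi_std : extform R 7 :=
  e [:: 1; 2; 3]%N + e [:: 1; 4; 5]%N + e [:: 1; 6; 7]%N + e [:: 2; 4; 6]%N
  - e [:: 2; 5; 7]%N - e [:: 3; 4; 7]%N - e [:: 3; 5; 6]%N.

Definition is_positive phi : Prop :=
  exists M : 'M[R]_7, 0 < \det M /\ phi = pull M phi_std.

Definition is_metric_of phi g : Prop :=
  [/\ g^T = g,
      forall v : 'rV[R]_7, v != 0 -> 0 < (v *m g *m v^T) 0 0
    & forall x y : 'rV[R]_7,
        (6 * (x *m g *m y^T) 0 0) *: vol g =
        wedge (wedge (interior_prod x phi) (interior_prod y phi)) phi].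

Definition metric_of phi : 'M[R]_7 := xget 0 [set g | is_metric_of phi g]%classic.

Definition star phi : extform R 7 -> extform R 7 := hodge (metric_of phi).

Definition is_dual psi phi : Prop := is_positive phi /\ star phi phi = psi.

(* The positive 3-form determined by psi (and the orientation). *)
Definition G2_of psi : extform R 7 := xget 0 [set phi | is_dual psi phi]%classic.

Definition Delta br psi : extform R 7 -> extform R 7 :=
  laplacian br (metric_of (G2_of psi)).

Definition coflow_solution br (I : set R) (psi_ : R -> extform R 7) : Prop :=
  forall t, I t ->
    (exists phi, is_dual (psi_ t) phi) /\
    form_is_derive psi_ t (- Delta br (psi_ t) (psi_ t)).

End G2.

Section LieGroup.
Context {R : realType}.

Definition adA : 'M[R]_7 :=
  \matrix_(i, j)
    ((i.+1, j.+1) \in [:: (1, 6); (6, 1); (3, 4); (4, 3)]%N)%:R.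

(* [e_7, e_i] = A e_i for i <= 6 and [e_i, e_j] = 0 for i, j <= 6. *)
Definition bracket (x y : 'rV[R]_7) : 'rV[R]_7 :=
  x 0 ord_max *: (y *m adA) - y 0 ord_max *: (x *m adA).

Lemma bracketxx x : bracket x x = 0.
Proof. by rewrite /bracket subrr. Qed.

Lemma bracket_jacobi x y z :
  bracket x (bracket y z) + bracket y (bracket z x) + bracket z (bracket x y)
  = 0.
Proof.
have A7 (u : 'rV[R]_7) : (u *m adA) 0 ord_max = 0.
  by rewrite mxE big1 // => i _; rewrite !mxE /= !inE !xpair_eqE !andbF mulr0.
have Z (s t : R) (a b : 'rV[R]_7) : a 0 ord_max = 0 -> b 0 ord_max = 0 ->
    (s *: a - t *: b) 0 ord_max = 0.
  by move=> a0 b0; rewrite !mxE a0 b0 !mulr0 subr0.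
have B7 u v : bracket u v 0 ord_max = 0 by apply: Z; exact: A7.
rewrite {1}/bracket [bracket y (bracket _ _)]/bracket.
rewrite [bracket z (bracket _ _)]/bracket !B7 !scale0r !subr0 /bracket.
rewrite !mulmxBl -!scalemxAl.
move: (x *m adA *m adA) (y *m adA *m adA) (z *m adA *m adA) => a b c.
by apply/rowP => i; rewrite !mxE; ring.
Qed.

(* The 1-connected group of this Lie algebra is R^7 = R^6 x R with product
   (x, s) (y, t) = (x + e^(s A) y, s + t); note that e^(s adA) fixes e_7 and
   the last coordinate. Its left-invariant frame e^(s A) e_i (i <= 6), d/ds
   satisfies the bracket relations above. *)
Definition gmul (p q : 'rV[R]_7) : 'rV[R]_7 :=
  p + q *m expM (p 0 ord_max *: adA).

Definition ginv (p : 'rV[R]_7) : 'rV[R]_7 :=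
  - (p *m expM (- p 0 ord_max *: adA)).

(* A differential form on G is written in the global coordinates of R^7. *)
Definition diff_form := 'rV[R]_7 -> extform R 7.

Definition pull_form (F : 'rV[R]_7 -> 'rV[R]_7) (w : diff_form) : diff_form :=
  fun p => pull (jacobian F p) (w (F p)).

(* The left-invariant form with value a at the identity:
   its value at p is (L_(p^-1))^* a. *)
Definition left_invariant_form (a : extform R 7) : diff_form :=
  fun p => pull (jacobian (gmul (ginv p)) p) a.

Fixpoint Ck (k : nat) (F : 'rV[R]_7 -> 'rV[R]_7) : Prop :=
  if k is k'.+1 then
    (forall p, differentiable F p) /\ forall v, Ck k' (fun p => 'D_v F p)
  else continuous F.

Definition diffeomorphism (F : 'rV[R]_7 -> 'rV[R]_7) : Prop :=
  exists F' : 'rV[R]_7 -> 'rV[R]_7,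
    [/\ cancel F F', cancel F' F, forall k, Ck k F & forall k, Ck k F'].

Definition self_similar (I : set R) (psi : extform R 7)
    (psi_ : R -> extform R 7) : Prop :=
  exists (b : R -> R) (F : R -> 'rV[R]_7 -> 'rV[R]_7),
    forall t, I t ->
      [/\ b t != 0, diffeomorphism (F t)
        & forall p, left_invariant_form (psi_ t) p =
                    b t *: pull_form (F t) (left_invariant_form psi) p].

End LieGroup.

(* Main.v *)
Require Import Defs.
From HB Require Import structures.
From mathcomp Require Import all_boot all_order all_algebra.
From mathcomp Require Import all_fingroup.
From mathcomp Require Import all_classical all_reals all_analysis.
From mathcomp Require Import ring lra.

Import Order.TTheory GRing.Theory Num.Theory.
Import numFieldNormedType.Exports.

Local Open Scope ring_scope.

Set Implicit Arguments.
Unset Strict Implicit.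
Unset Printing Implicit Defensive.

(** The form psi is closed and Delta psi = 4 (e^1457 + e^3567).  Under the derivation D
    the monomials of psi have weight 8, except e^1457 and e^3567, which have weight 4;
    hence L_D psi - 8 psi = - Delta psi.  This is also - theta(D - 2) psi, since the
    scalar 2 acts on 4-forms with weight 8.  The automorphisms f(t) scale monomials by their
    weights, so psi_t is affine in t: only the coefficient 1 - 4 t of e^1457 + e^3567
    moves.  It solves the co-flow because Delta psi_t does not depend on t: the powers
    of the scaling parameter cancel ([Delta_flow]).

    The Laplacian of psi_t refers to the metric of the positive 3-form determined by
    psi_t, so the main point is that this form is the expected one.  Every psi_t is a
    pullback N^* psi with det N > 0, and every positive form is a pullback M^* phi, whose
    metric is M M^T ([metric_pull]) and whose dual is M^* psi ([star_pull]).  Uniqueness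
    reduces to the fact that an orientation preserving linear map fixing psi fixes phi
    ([stabilizer_of_dual], [dual_unique]).  This rests on the naturality of the Hodge star
    ([hodge_pull1], [hodge_pull]), which follows from two properties of the substitution
    [pull M]: the substitution by the transpose is its adjoint ([pairing_pull]), and it
    acts by the determinant in top degree ([pull_top]).

    The remaining identities have integral coefficients.  They are verified by computing
    with lists of monomials, two lists being compared after their monomials are sorted
    with signs ([eqLP]).  Self-similarity holds since diagonal automorphisms of the Lie
    algebra are also the automorphisms of G in its global coordinates
    ([pull_form_automorphism]). *)

(** * The exterior algebra of a finite-dimensional space *)

Section ExtAlg.
Context {R : realType} {n : nat}.
Implicit Types (a b : extform R n) (S T U : {set 'I_n}) (M N : 'M[R]_n).

Definition eset S : extform R n := [ffun U => (U == S)%:R].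

Lemma form_expansion a : a = \sum_(S : {set 'I_n}) a S *: eset S.
Proof.
apply/ffunP => U; rewrite sum_ffunE (bigD1 U) //= big1 => [|S neqSU].
  by rewrite !ffunE eqxx addr0 [_ *: _]mulr1.
by rewrite !ffunE eq_sym (negPf neqSU) scaler0.
Qed.

Lemma eset_neq0 S : eset S != 0.
Proof.
apply/eqP => /ffunP/(_ S)/eqP; rewrite !ffunE eqxx.
by rewrite (negPf (oner_neq0 _)).
Qed.

Lemma cov_eset k : cov k = eset [set k] :> extform R n.
Proof. by []. Qed.

Lemma wedgeDl a b c : wedge (a + b) c = wedge a c + wedge b c.
Proof.
apply/ffunP => U; rewrite !ffunE -big_split; apply: eq_bigr => S _ /=.
by rewrite ffunE mulrDl mulrDr.
Qed.

Lemma wedgeDr a b c : wedge a (b + c) = wedge a b + wedge a c.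
Proof.
apply/ffunP => U; rewrite !ffunE -big_split; apply: eq_bigr => S _ /=.
by rewrite ffunE !mulrDr.
Qed.

Lemma wedgeZl x a b : wedge (x *: a) b = x *: wedge a b.
Proof.
apply/ffunP => U; rewrite !ffunE /GRing.scale /= mulr_sumr; apply: eq_bigr => S _ /=.
by rewrite ffunE /GRing.scale /=; ring.
Qed.

Lemma wedgeZr x a b : wedge a (x *: b) = x *: wedge a b.
Proof.
apply/ffunP => U; rewrite !ffunE /GRing.scale /= mulr_sumr; apply: eq_bigr => S _ /=.
by rewrite ffunE /GRing.scale /=; ring.
Qed.

Lemma wedge0l b : wedge 0 b = 0.
Proof. by have := wedgeZl 0 0 b; rewrite !scale0r. Qed.

Lemma wedge0r a : wedge a 0 = 0.
Proof. by have := wedgeZr 0 a 0; rewrite !scale0r. Qed.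

Lemma wedgeNl a b : wedge (- a) b = - wedge a b.
Proof. by rewrite -scaleN1r wedgeZl scaleN1r. Qed.

Lemma wedge_suml (I : Type) (r : seq I) (P : pred I) (F : I -> extform R n) b :
  wedge (\sum_(i <- r | P i) F i) b = \sum_(i <- r | P i) wedge (F i) b.
Proof.
by apply: (big_morph (fun a => wedge a b)) => [? ?|]; rewrite ?wedgeDl ?wedge0l.
Qed.

Lemma wedge_sumr (I : Type) (r : seq I) (P : pred I) (F : I -> extform R n) a :
  wedge a (\sum_(i <- r | P i) F i) = \sum_(i <- r | P i) wedge a (F i).
Proof. by apply: big_morph => [? ?|]; rewrite ?wedgeDr ?wedge0r. Qed.

Lemma wedge_eset S T :
  wedge (eset S) (eset T) =
  if S :&: T == finset.set0 then (-1) ^+ inversions S T *: eset (S :|: T) else 0.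
Proof.
apply/ffunP => U; rewrite ffunE.
have [ST|nST] := boolP (_ == _); last first.
  rewrite ffunE big1 // => V _; rewrite !ffunE.
  have [->|] := eqVneq V S; last by rewrite mul0r mulr0.
  have [UST|] := eqVneq (U :\: S) T; last by rewrite !mulr0.
  case/negP: nST; rewrite -UST; apply/eqP/finset.setP => x.
  by rewrite !inE; case: (x \in S).
rewrite !ffunE.
have [UST|UST] := eqVneq U (S :|: T).
  have SU : S \in powerset U by rewrite inE UST finset.subsetUl.
  have UT : U :\: S = T.
    apply/finset.setP => x; move/eqP/finset.setP/(_ x): ST.
    by rewrite UST !inE; do 2!case: (x \in _).
  rewrite (bigD1 S) //= !ffunE UT !eqxx big1 ?addr0 ?mulr1 //.
    by rewrite [RHS]mulr1.
  by move=> V /andP[_ VS]; rewrite !ffunE (negPf VS) mul0r mulr0.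
rewrite scaler0 big1 // => V; rewrite inE => VU; rewrite !ffunE.
have [VS|] := eqVneq V S; last by rewrite mul0r mulr0.
have [UT|] := eqVneq (U :\: V) T; last by rewrite !mulr0.
case/eqP: UST; rewrite -UT -VS; apply/finset.setP => x; rewrite !inE.
by have /fintype.subsetP/(_ x) := VU; case: (x \in V) => //= ->.
Qed.

Lemma inversionsUl S T U : S :&: T == finset.set0 ->
  inversions (S :|: T) U = (inversions S U + inversions T U)%N.
Proof.
move=> /eqP/finset.setP ST; rewrite /inversions -cardsUI.
rewrite [X in (_ + X)%N](_ : _ = 0)%N ?addn0; last first.
  apply/eqP; rewrite cards_eq0; apply/eqP/finset.setP => -[i j]; rewrite !inE /=.
  by have := ST i; rewrite !inE; case: (i \in S) => //= ->; rewrite andbF.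
by apply: eq_card => -[i j]; rewrite !inE /= andb_orl.
Qed.

Lemma inversionsUr S T U : T :&: U == finset.set0 ->
  inversions S (T :|: U) = (inversions S T + inversions S U)%N.
Proof.
move=> /eqP/finset.setP TU; rewrite /inversions -cardsUI.
rewrite [X in (_ + X)%N](_ : _ = 0)%N ?addn0; last first.
  apply/eqP; rewrite cards_eq0; apply/eqP/finset.setP => -[i j]; rewrite !inE /=.
  by have := TU j; rewrite !inE; case: (j \in T) => /= [->|]; rewrite ?andbF.
by apply: eq_card => -[i j]; rewrite !inE /= andb_orl andb_orr.
Qed.

Lemma inversions0l S : inversions finset.set0 S = 0%N.
Proof.
by apply/eqP; rewrite cards_eq0; apply/eqP/finset.setP => p; rewrite !inE.
Qed.

Lemma inversions0r S : inversions S finset.set0 = 0%N.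
Proof.
by apply/eqP; rewrite cards_eq0; apply/eqP/finset.setP => p; rewrite !inE andbF.
Qed.

Lemma wedge1l : left_id ext_one (@wedge R n).
Proof.
move=> a; rewrite (form_expansion a) wedge_sumr; apply: eq_bigr => S _.
have -> : ext_one = eset finset.set0 by [].
by rewrite wedgeZr wedge_eset finset.set0I eqxx inversions0l finset.set0U scale1r.
Qed.

Lemma wedge1r : right_id ext_one (@wedge R n).
Proof.
move=> a; rewrite {1 2}(form_expansion a) wedge_suml; apply: eq_bigr => S _.
have -> : ext_one = eset finset.set0 by [].
by rewrite wedgeZl wedge_eset finset.setI0 eqxx inversions0r finset.setU0 scale1r.
Qed.

(** On monomials both bracketings carry the sign of the inversions of S, T and U
    taken pairwise, because inversions are additive in each argument; the two
    sides vanish together unless the three sets are pairwise disjoint. *)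
Lemma wedgeA : associative (@wedge R n).
Proof.
move=> a b c; rewrite (form_expansion a) (form_expansion b) (form_expansion c).
rewrite !wedge_suml; apply: eq_bigr => S _.
rewrite [LHS]wedge_sumr [X in _ = wedge X _]wedge_sumr [RHS]wedge_suml.
apply: eq_bigr => T _.
rewrite !wedge_sumr; apply: eq_bigr => U _.
suff E : wedge (eset S) (wedge (eset T) (eset U)) =
         wedge (wedge (eset S) (eset T)) (eset U).
  by rewrite !(wedgeZl, wedgeZr) E !scalerA; congr (_ *: _); ring.
rewrite !wedge_eset.
have [ST|nST] := boolP (S :&: T == _); have [TU|nTU] := boolP (T :&: U == _);
  rewrite ?wedgeZl ?wedgeZr ?wedge0l ?wedge0r ?wedge_eset //.
- rewrite finset.setIUl finset.setIUr !finset.setU_eq0 ST TU andbT /=.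
  case: eqP => SU; rewrite ?scaler0 //.
  by rewrite inversionsUl // inversionsUr // !exprD !scalerA finset.setUA;
     congr (_ *: _); ring.
- by rewrite finset.setIUl finset.setU_eq0 (negPf nTU) andbF scaler0.
- by rewrite finset.setIUr finset.setU_eq0 (negPf nST) scaler0.
Qed.

HB.instance Definition _ :=
  Monoid.isLaw.Build (extform R n) ext_one wedge wedgeA wedge1l wedge1r.
HB.instance Definition _ :=
  Monoid.isMulLaw.Build (extform R n) 0 wedge wedge0l wedge0r.
(** Canonical inference associates addition with the product of a ring; this packs
    it with the wedge, so that products of sums can be expanded. *)
Definition ext_add : Monoid.add_law 0 (@wedge R n) :=
  HB.pack (+%R : extform R n -> extform R n -> extform R n)
    (Monoid.isComLaw.Build (extform R n) 0 +%R (@addrA _) (@addrC _) (@add0r _))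
    (Monoid.isAddLaw.Build (extform R n) wedge +%R wedgeDl wedgeDr).

Lemma wedge_distr (I J : finType) (F : I -> J -> extform R n) :
  \big[wedge/ext_one]_i \sum_j F i j =
  \sum_(f : {ffun I -> J}) \big[wedge/ext_one]_i F i (f i).
Proof. exact: (@bigA_distr_bigA _ 0 ext_one wedge ext_add). Qed.

End ExtAlg.

(** * Substitutions, contractions and the Euclidean pairing *)

Section Generators.
Context {R : realType} {n : nat}.
Implicit Types (a b : extform R n) (S T U : {set 'I_n}) (M N : 'M[R]_n).

Definition oneform (c : 'I_n -> R) : extform R n := \sum_(j < n) c j *: cov j.

Lemma oneform_cov k : oneform (fun j => (j == k)%:R) = cov k.
Proof.
rewrite /oneform (bigD1 k) //= eqxx scale1r big1 ?addr0 // => j /negPf->.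
by rewrite scale0r.
Qed.

Lemma inversions1l k U : inversions [set k] U = #|[set j in U | (j < k)%N]|.
Proof.
rewrite /inversions -[RHS](@card_imset _ _ (fun j => (k, j))) => [|? ? []//].
apply: eq_card => -[i j]; rewrite !inE /=; apply/and3P/imsetP => /=.
  by case=> /eqP-> jU ji; exists j; rewrite // inE jU.
by case=> x; rewrite inE => /andP[xU xk] [-> ->].
Qed.

Lemma inversions11 (k l : 'I_n) : inversions [set k] [set l] = (l < k)%N.
Proof.
rewrite inversions1l; case: ltnP => lk.
  apply/eqP/cards1P; exists l; apply/finset.setP => x.
  by rewrite !inE; case: eqP => //= ->.
apply/eqP; rewrite cards_eq0; apply/eqP/finset.setP => x; rewrite !inE.
by case: eqP => //= ->; rewrite ltnNge lk.
Qed.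

Lemma wedge_covC (i j : 'I_n) :
  wedge (cov i) (cov j) = - wedge (cov j) (cov i) :> extform R n.
Proof.
rewrite !cov_eset !wedge_eset finset.setIC.
have [->|neq] := eqVneq i j.
  case: ifP; rewrite ?oppr0 // => /eqP/finset.setP/(_ j).
  by rewrite !inE eqxx.
case: ifP => _; last by rewrite oppr0.
rewrite finset.setUC -scaleNr !inversions11; congr (_ *: _).
by case: ltngtP neq; rewrite ?expr1 ?expr0 ?opprK // => /val_inj->; rewrite eqxx.
Qed.

Lemma wedge_oneformC (c d : 'I_n -> R) :
  wedge (oneform c) (oneform d) = - wedge (oneform d) (oneform c).
Proof.
rewrite /oneform !wedge_suml -sumrN.
under eq_bigr do rewrite wedge_sumr.
under [RHS]eq_bigr do rewrite wedge_sumr -sumrN.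
rewrite exchange_big; apply: eq_bigr => i _; apply: eq_bigr => j _.
by rewrite !(wedgeZl, wedgeZr) wedge_covC !scalerN !scalerA mulrC.
Qed.

Lemma anti_eq0 a : a = - a -> a = 0.
Proof.
move=> aN; apply/ffunP => S; move/ffunP/(_ S): aN; rewrite !ffunE.
by move: (a S : R) => x xN; apply/eqP; lra.
Qed.

Definition wedge_prod (I : Type) (v : I -> extform R n) (s : seq I) : extform R n :=
  \big[wedge/ext_one]_(k <- s) v k.

Lemma wedge_prod_cons (I : Type) (v : I -> extform R n) k s :
  wedge_prod v (k :: s) = wedge (v k) (wedge_prod v s).
Proof. exact: big_cons. Qed.

Lemma wedge_prod_cat (I : Type) (v : I -> extform R n) s t :
  wedge_prod v (s ++ t) = wedge (wedge_prod v s) (wedge_prod v t).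
Proof. exact: big_cat. Qed.

Definition anticomm (I : Type) (v : I -> extform R n) :=
  forall i j, wedge (v i) (v j) = - wedge (v j) (v i).

Lemma ord_ltn_trans : transitive (fun i j : 'I_n => i < j)%N.
Proof. by move=> ? ? ?; exact: ltn_trans. Qed.

Definition increasing (s : seq 'I_n) := sorted (fun i j : 'I_n => i < j)%N s.

(** Reordering uses nothing but anticommutation, so the scalar c and the sorted
    list t' serve every anticommuting family at once.  This uniformity is what makes
    [pull M], defined on sorted products only, multiplicative. *)
Lemma insert_wedge_prod (k : 'I_n) (t : seq 'I_n) : increasing t ->
  exists (c : R) (t' : seq 'I_n), [/\ increasing t', {subset t' <= k :: t}
    & forall v, anticomm v -> wedge_prod v (k :: t) = c *: wedge_prod v t'].
Proof.
elim: t => [|i t IH] incr_t; first by exists 1, [:: k]; split=> // v _; rewrite scale1r.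
have [ki|ik|/val_inj ki] := ltngtP k i.
- by exists 1, [:: k, i & t]; split=> [|//|v _]; rewrite ?scale1r /increasing //= ki.
- have [c [u [incr_u sub_u vu]]] := IH (path_sorted incr_t).
  exists (- c), (i :: u); split.
  + rewrite /increasing /= path_min_sorted //; apply/allP => j /sub_u.
    rewrite inE => /predU1P[->//|].
    by move: j; apply/allP; apply: (order_path_min ord_ltn_trans) incr_t.
  + move=> j; rewrite inE => /predU1P[->|/sub_u]; rewrite !inE ?eqxx ?orbT //.
    by case/orP => ->; rewrite ?orbT.
  + move=> v anti_v; rewrite !wedge_prod_cons wedgeA anti_v wedgeNl -wedgeA.
    by rewrite -(wedge_prod_cons v k t) vu // wedgeZr scaleNr.
- exists 0, [::]; split=> // v anti_v; rewrite ki scale0r !wedge_prod_cons wedgeA.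
  by rewrite [wedge (v i) _]anti_eq0 ?wedge0l //; exact: anti_v.
Qed.

Lemma sort_wedge_prod (s : seq 'I_n) : exists (c : R) (t : seq 'I_n), increasing t /\
  forall v, anticomm v -> wedge_prod v s = c *: wedge_prod v t.
Proof.
elim: s => [|k s [c [t [incr_t vt]]]].
  by exists 1, [::]; split=> // v _; rewrite scale1r.
have [c' [u [incr_u _ vu]]] := insert_wedge_prod k incr_t.
exists (c * c'), u; split=> // v anti_v.
by rewrite wedge_prod_cons vt // wedgeZr -wedge_prod_cons vu // scalerA.
Qed.

Lemma increasing_eset t : increasing t -> wedge_prod cov t = eset [set k in t] :> extform R n.
Proof.
elim: t => [_|i t IH it].
  by rewrite /wedge_prod big_nil; congr eset; apply/finset.setP => x; rewrite !inE.
have /allP lt_it := order_path_min ord_ltn_trans it.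
rewrite wedge_prod_cons (IH (path_sorted it)) cov_eset wedge_eset ifT; last first.
  apply/eqP/finset.setP => x; rewrite !inE; case: eqP => //= ->.
  by apply/negP => /lt_it; rewrite ltnn.
rewrite (_ : inversions _ _ = 0%N) ?scale1r.
  by congr eset; apply/finset.setP => x; rewrite !inE.
apply/eqP; rewrite cards_eq0; apply/eqP/finset.setP => -[x y]; rewrite !inE /=.
case: eqP => //= ->; case: (boolP (y \in t)) => //= /lt_it iy.
by rewrite ltnNge ltnW.
Qed.

Lemma enum_increasing S : increasing (enum S).
Proof.
rewrite /increasing /(enum _) (sorted_filter ord_ltn_trans) //.
have /= <- := @sorted_map _ _ (@nat_of_ord n) ltn (Finite.enum 'I_n).
by rewrite -enumT val_enum_ord iota_ltn_sorted.
Qed.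

Lemma wedge_prod_set (v : 'I_n -> extform R n) S :
  \big[wedge/ext_one]_(k in S) v k = wedge_prod v (enum S).
Proof. by rewrite /wedge_prod /(enum _) big_filter. Qed.

Lemma eset_wedge_prod S : eset S = wedge_prod cov (enum S) :> extform R n.
Proof.
rewrite increasing_eset ?enum_increasing //; congr eset; apply/finset.setP => x.
by rewrite !inE mem_enum.
Qed.

(** Forms are generated from 1 by multiplication with the covectors e^k and linear
    combinations; identities between linear maps are proved along this. *)
Lemma form_ind (P : extform R n -> Prop) : P ext_one ->
  (forall k a, P a -> P (wedge (cov k) a)) ->
  (forall x a b, P a -> P b -> P (x *: a + b)) -> forall a, P a.
Proof.
move=> P1 Pcov PZD a.
have Pbas S : P (eset S).
  rewrite eset_wedge_prod; elim: (enum _) => [|k s IH]; first by rewrite /wedge_prod big_nil.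
  by rewrite wedge_prod_cons; apply: Pcov.
have P0 : P 0 by have := PZD (-1) _ _ P1 P1; rewrite scaleN1r addNr.
rewrite (form_expansion a); elim/big_ind: _ => // [x y Px Py|S _].
  by rewrite -(scale1r x); apply: PZD.
by rewrite -[_ *: _]addr0; apply: PZD.
Qed.

Lemma pull_linear M : linear (@pull R n M).
Proof.
move=> x a b; rewrite /pull scaler_sumr -big_split; apply: eq_bigr => S _ /=.
by rewrite !ffunE scalerA -scalerDl.
Qed.

HB.instance Definition _ M :=
  GRing.isLinear.Build R (extform R n) (extform R n) _ (pull M) (pull_linear M).

Lemma pull_eset M S :
  pull M (eset S) = \big[wedge/ext_one]_(k in S) oneform (M^~ k).
Proof.
rewrite /pull (bigD1 S) //= [X in _ + X]big1 => [|T TS].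
  by rewrite ffunE eqxx scale1r addr0.
by rewrite ffunE (negPf TS) scale0r.
Qed.

Lemma pull_increasing M t : increasing t ->
  pull M (wedge_prod cov t) = wedge_prod (fun k => oneform (M^~ k)) t.
Proof.
move=> it; rewrite increasing_eset // pull_eset wedge_prod_set; congr wedge_prod.
by apply: (irr_sorted_eq ord_ltn_trans _ (enum_increasing _) it) => i; rewrite ?ltnn // mem_enum inE.
Qed.

Lemma pull1form M : pull M ext_one = ext_one.
Proof. by have := @pull_increasing M [::] isT; rewrite /wedge_prod !big_nil. Qed.

(** Sort the product of the e^k and the product of their images with the same
    sign. *)
Lemma pull_wedge_prod M s :
  pull M (wedge_prod cov s) = wedge_prod (fun k => oneform (M^~ k)) s.
Proof.
have [c [t [it E]]] := sort_wedge_prod s.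
rewrite (E cov wedge_covC) linearZ /= (pull_increasing _ it) -E // => i j.
exact: wedge_oneformC.
Qed.

Lemma pull_cov M k : pull M (cov k) = oneform (M^~ k).
Proof. by have := pull_wedge_prod M [:: k]; rewrite /wedge_prod !big_seq1. Qed.

Lemma pull_diag_cov (v : 'rV[R]_n) k : pull (diag_mx v) (cov k) = v 0 k *: cov k.
Proof.
rewrite pull_cov -oneform_cov /oneform scaler_sumr; apply: eq_bigr => j _.
by rewrite !mxE scalerA; case: eqP => [->|]; rewrite ?mulr1 ?mulr0.
Qed.

Lemma pull_wedge_cov M k a :
  pull M (wedge (cov k) a) = wedge (oneform (M^~ k)) (pull M a).
Proof.
rewrite (form_expansion a) wedge_sumr !linear_sum wedge_sumr; apply: eq_bigr => S _ /=.
rewrite wedgeZr !linearZ /= wedgeZr; congr (_ *: _).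
by rewrite eset_wedge_prod -wedge_prod_cons !pull_wedge_prod wedge_prod_cons.
Qed.

Lemma pull_wedge M a b : pull M (wedge a b) = wedge (pull M a) (pull M b).
Proof.
elim/form_ind: a => [|k a IH|x a a' IH IH'].
- by rewrite pull1form !wedge1l.
- by rewrite -wedgeA !pull_wedge_cov IH wedgeA.
- by rewrite wedgeDl wedgeZl !pull_linear IH IH' wedgeDl wedgeZl.
Qed.

Lemma pull_oneform M c : pull M (oneform c) = oneform (fun i => \sum_j M i j * c j).
Proof.
rewrite /oneform linear_sum /=.
under eq_bigr do rewrite linearZ /= pull_cov scaler_sumr.
rewrite exchange_big; apply: eq_bigr => i _ /=.
by rewrite scaler_suml; apply: eq_bigr => j _; rewrite scalerA mulrC.
Qed.

Lemma pull_mul M N a : pull (M *m N) a = pull M (pull N a).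
Proof.
elim/form_ind: a => [|k a IH|x a b IHa IHb]; first by rewrite !pull1form.
  rewrite !pull_wedge IH !pull_cov pull_oneform; congr (wedge (oneform _) _).
  by apply/funext => i; rewrite mxE.
by rewrite !pull_linear IHa IHb.
Qed.

Lemma pull_id a : pull 1%:M a = a.
Proof.
elim/form_ind: a => [|k a IH|x a b IHa IHb]; first by rewrite pull1form.
  rewrite pull_wedge IH pull_cov -[in RHS](oneform_cov k); congr (wedge (oneform _) _).
  by apply/funext => i; rewrite mxE.
by rewrite pull_linear IHa IHb.
Qed.

Lemma contract_linear k : linear (@contract_basis R n k).
Proof.
move=> x a b; apply/ffunP => U; rewrite !ffunE; case: ifP => _.
  by rewrite scaler0 addr0.
by rewrite /GRing.scale /=; ring.
Qed.

HB.instance Definition _ k :=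
  GRing.isLinear.Build R (extform R n) (extform R n) _ (contract_basis k)
    (contract_linear k).

Lemma contract_one k : contract_basis k ext_one = 0 :> extform R n.
Proof.
apply/ffunP => U; rewrite !ffunE; case: ifP => // _.
rewrite (_ : (_ == _) = false) ?mulr0 //.
by apply/eqP => /finset.setP/(_ k); rewrite !inE eqxx.
Qed.

Lemma contract_eset k S : contract_basis k (eset S) =
  if k \in S then (-1) ^+ inversions [set k] S *: eset (S :\ k) else 0 :> extform R n.
Proof.
apply/ffunP => U; rewrite !ffunE; case: ifP => kU.
  case: ifP => kS; rewrite !ffunE // (_ : (_ == _) = false) ?scaler0 //.
  by apply/eqP => US; move: kU; rewrite US !inE eqxx.
have [<-|kUS] := eqVneq (k |: U) S.
  rewrite setU11 !ffunE mulr1 setU1K ?kU // eqxx [RHS]mulr1 inversions1l.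
  congr (_ ^+ _); apply: eq_card => j; rewrite !inE.
  by case: eqP => //= ->; rewrite ltnn andbF.
rewrite mulr0; case: ifP => kS; rewrite !ffunE // (_ : (_ == _) = false) ?scaler0 //.
by apply/eqP => US; move/eqP: kUS; rewrite US finset.setD1K.
Qed.

Lemma wedge_cov_eset k S : wedge (cov k) (eset S) =
  if k \in S then 0 else (-1) ^+ inversions [set k] S *: eset (k |: S) :> extform R n.
Proof.
rewrite cov_eset wedge_eset finset.setI_eq0 disjoints1.
by case: (k \in S).
Qed.

(** Contraction is an antiderivation.  For distinct i and k the two orders of
    inserting i and removing k differ by the single inversion between them, which
    gives the minus sign. *)
Lemma contract_wedge_cov k i a :
  contract_basis k (wedge (cov i) a) =
  (i == k)%:R *: a - wedge (cov i) (contract_basis k a).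
Proof.
rewrite (form_expansion a) wedge_sumr !linear_sum wedge_sumr -sumrB.
apply: eq_bigr => S _ /=; rewrite wedgeZr !linearZ /= wedgeZr.
rewrite -scalerBr; congr (_ *: _).
rewrite wedge_cov_eset contract_eset.
have sgn2 m : (-1 : R) ^+ m * (-1) ^+ m = 1.
  by rewrite -exprD addnn -signr_odd odd_double.
have [<-{k}|neqik] := eqVneq i k; rewrite ?scale1r ?scale0r.
  have [iS|iS] := boolP (i \in S).
    rewrite linear0 wedgeZr wedge_cov_eset !inE eqxx /= finset.setD1K //.
    rewrite scalerA !inversions1l.
    rewrite (_ : #|[set j in S :\ i | _]| = #|[set j in S | (j < i)%N]|).
      by rewrite sgn2 scale1r subrr.
    by apply: eq_card => j; rewrite !inE; case: eqP => //= ->; rewrite ltnn andbF.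
  rewrite wedge0r subr0 linearZ /= contract_eset setU11 setU1K // scalerA !inversions1l.
  rewrite (_ : #|[set j in i |: S | _]| = #|[set j in S | (j < i)%N]|).
    by rewrite sgn2 scale1r.
  by apply: eq_card => j; rewrite !inE; case: eqP => //= ->; rewrite ltnn andbF.
rewrite sub0r; have [iS|iS] := boolP (i \in S).
  rewrite linear0; case: ifP => kS; rewrite ?wedge0r ?oppr0 // wedgeZr wedge_cov_eset.
  by rewrite !inE neqik iS scaler0 oppr0.
rewrite linearZ /= contract_eset !inE eq_sym (negPf neqik) /=.
case: ifP => kS; rewrite ?wedge0r ?oppr0 ?scaler0 // wedgeZr wedge_cov_eset.
rewrite !inE (negPf iS) andbF !scalerA -scaleNr.
rewrite (_ : (i |: S) :\ k = i |: (S :\ k)); last first.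
  by apply/finset.setP => x; rewrite !inE; case: eqP => // ->; rewrite (eq_sym k) (negPf neqik).
congr (_ *: _); rewrite inversionsUr; last first.
  by rewrite finset.setI_eq0 disjoints1.
have E : inversions [set i] S = (inversions [set i] (S :\ k) + inversions [set i] [set k])%N.
  rewrite -inversionsUr ?(finset.setUC (S :\ k)) ?finset.setD1K //.
  by rewrite finset.setIC finset.setI_eq0 disjoints1 !inE eqxx.
rewrite E !inversions11 !exprD.
by case: ltngtP neqik => [| |/val_inj->]; rewrite ?eqxx // => _ _;
   rewrite ?expr1 ?expr0; ring.
Qed.

Lemma interior_linear (v : 'rV[R]_n) : linear (interior_prod v).
Proof.
move=> x a b; rewrite /interior_prod scaler_sumr -big_split; apply: eq_bigr => k _ /=.
by rewrite contract_linear scalerDr !scalerA mulrC.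
Qed.

HB.instance Definition _ (v : 'rV[R]_n) :=
  GRing.isLinear.Build R (extform R n) (extform R n) _ (interior_prod v)
    (interior_linear v).

Lemma interior_one (v : 'rV[R]_n) : interior_prod v ext_one = 0.
Proof. by rewrite /interior_prod big1 // => k _; rewrite contract_one scaler0. Qed.

Lemma interior_wedge_cov (v : 'rV[R]_n) i a :
  interior_prod v (wedge (cov i) a) = v 0 i *: a - wedge (cov i) (interior_prod v a).
Proof.
rewrite /interior_prod wedge_sumr (bigD1 i) //= contract_wedge_cov eqxx scale1r.
rewrite scalerBr -addrA; congr (_ + _).
rewrite [in RHS](bigD1 i) //= opprD wedgeZr; congr (_ + _); rewrite -sumrN.
apply: eq_bigr => k ki; rewrite contract_wedge_cov eq_sym (negPf ki) scale0r sub0r.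
by rewrite scalerN wedgeZr.
Qed.

Lemma interior_wedge_oneform (v : 'rV[R]_n) c a :
  interior_prod v (wedge (oneform c) a) =
  (\sum_j v 0 j * c j) *: a - wedge (oneform c) (interior_prod v a).
Proof.
rewrite /oneform !wedge_suml linear_sum scaler_suml -sumrB.
apply: eq_bigr => j _; rewrite !wedgeZl linearZ /= interior_wedge_cov scalerBr.
by rewrite scalerA mulrC.
Qed.

(** Both sides are antiderivations along [pull M] that agree on covectors. *)
Lemma interior_pull (v : 'rV[R]_n) M a :
  interior_prod v (pull M a) = pull M (interior_prod (v *m M) a).
Proof.
elim/form_ind: a => [|k a IH|x a b IHa IHb].
- by rewrite pull1form !interior_one linear0.
- rewrite pull_wedge_cov interior_wedge_oneform IH interior_wedge_cov linearB /=.
  by rewrite linearZ /= pull_wedge_cov mxE.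
- by rewrite pull_linear !interior_linear pull_linear IHa IHb.
Qed.

(** The inner product for which the monomials e^S are orthonormal. *)
Definition pairing a b : R := \sum_(S : {set 'I_n}) a S * b S.

Lemma pairingDl x a a' b : pairing (x *: a + a') b = x * pairing a b + pairing a' b.
Proof.
rewrite /pairing mulr_sumr -big_split; apply: eq_bigr => S _ /=.
by rewrite !ffunE mulrDl -mulrA.
Qed.

Lemma pairingC a b : pairing a b = pairing b a.
Proof. by apply: eq_bigr => S _; rewrite mulrC. Qed.

Lemma pairing_suml (I : Type) (r : seq I) (F : I -> extform R n) b :
  pairing (\sum_(i <- r) F i) b = \sum_(i <- r) pairing (F i) b.
Proof.
apply: (big_morph (fun a => pairing a b)) => [x y|].
  by rewrite -[x]scale1r pairingDl mul1r scale1r.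
by rewrite /pairing big1 // => S _; rewrite ffunE mul0r.
Qed.

Lemma pairingZl x a b : pairing (x *: a) b = x * pairing a b.
Proof. by rewrite /pairing mulr_sumr; apply: eq_bigr => S _; rewrite ffunE mulrA. Qed.

Lemma pairing_eset S a : pairing (eset S) a = a S.
Proof.
rewrite /pairing (bigD1 S) //= big1 => [|T TS]; rewrite !ffunE ?eqxx ?mul1r ?addr0 //.
by rewrite (negPf TS) mul0r.
Qed.

Lemma pairing_cov k a b : pairing (wedge (cov k) a) b = pairing a (contract_basis k b).
Proof.
rewrite (form_expansion a) wedge_sumr !pairing_suml; apply: eq_bigr => S _.
rewrite wedgeZr !pairingZl pairing_eset wedge_cov_eset !ffunE; congr (_ * _).
case: ifP => kS; first by rewrite -(scale0r 0) pairingZl mul0r.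
by rewrite pairingZl pairing_eset inversions1l.
Qed.

Lemma pairing_oneform c a b :
  pairing (wedge (oneform c) a) b = pairing a (interior_prod (\row_j c j) b).
Proof.
rewrite /oneform wedge_suml pairing_suml /interior_prod pairingC pairing_suml.
apply: eq_bigr => j _.
by rewrite wedgeZl !pairingZl pairing_cov pairingC mxE.
Qed.

(** Multiplication by a covector is adjoint to the contraction with the same
    coordinates, and [interior_pull] moves the contraction through the substitution;
    the adjunction follows by induction on products of covectors. *)
Lemma pairing_pull M a b : pairing (pull M a) b = pairing a (pull M^T b).
Proof.
elim/form_ind: a b => [b|k a IH b|x a a' IHa IHb b].
- rewrite pull1form -[ext_one]/(eset finset.set0) !pairing_eset.
  elim/form_ind: b => [|k b _|x b b' IH IH'].
  + by rewrite pull1form.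
  + rewrite pull_wedge_cov !ffunE !finset.powerset0 !big_set1 !ffunE.
    rewrite /oneform sum_ffunE big1 => [|j _].
      rewrite mul0r mulr0 (_ : (_ == _) = false) ?mul0r ?mulr0 //.
      by apply/eqP => /finset.setP/(_ k); rewrite !inE eqxx.
    rewrite !ffunE (_ : (_ == _) = false) ?mulr0 ?scaler0 //.
    by apply/eqP => /finset.setP/(_ j); rewrite !inE eqxx.
  + by rewrite pull_linear !ffunE IH IH'.
- rewrite pull_wedge_cov pairing_oneform IH pairing_cov -[contract_basis k _]/(contract_basis k _).
  have -> : contract_basis k (pull M^T b) = interior_prod (delta_mx 0 k) (pull M^T b).
    rewrite /interior_prod (bigD1 k) //= mxE !eqxx scale1r big1 ?addr0 // => j jk.
    by rewrite mxE eqxx (negPf jk) scale0r.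
  rewrite interior_pull; congr (pairing _ (pull _ (interior_prod _ _))).
  by apply/rowP => j; rewrite -rowE !mxE.
- by rewrite pull_linear !pairingDl IHa IHb.
Qed.
End Generators.

(** * The top degree and the determinant *)

Section Determinant.
Context {R : realType}.

Lemma wedge_prod_scale n (I : Type) (c : I -> R) (v : I -> extform R n) s :
  wedge_prod (fun k => c k *: v k) s = (\prod_(k <- s) c k) *: wedge_prod v s.
Proof.
elim: s => [|k s IH]; first by rewrite /wedge_prod !big_nil scale1r.
by rewrite !wedge_prod_cons big_cons IH wedgeZl wedgeZr scalerA.
Qed.

Lemma wedge_prod_eset n (s : seq 'I_n) :
  exists c : R, wedge_prod cov s = c *: eset [set k in s] /\ (~~ uniq s -> c = 0).
Proof.
elim: s => [|k s [c [E c0]]].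
  exists 1; split=> //; rewrite scale1r /wedge_prod big_nil.
  by apply/ffunP => S; rewrite !ffunE; congr (_ == _)%:R; apply/finset.setP => x; rewrite !inE.
rewrite wedge_prod_cons E wedgeZr wedge_cov_eset inE.
have [ks|ks] := boolP (k \in s).
  by exists 0; rewrite scaler0 scale0r.
exists (c * (-1) ^+ inversions [set k] [set i in s]); rewrite scalerA.
split; last by rewrite /= ks => /c0->; rewrite mul0r.
by congr (_ *: eset _); apply/finset.setP => x; rewrite !inE.
Qed.

Definition cov_prod n (f : 'I_n -> 'I_n) : extform R n :=
  \big[wedge/ext_one]_(k < n) cov (f k).

Lemma cov_prodE n (f : 'I_n -> 'I_n) :
  cov_prod f = wedge_prod cov [seq f k | k <- index_enum 'I_n].
Proof. by rewrite /wedge_prod big_map. Qed.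

Lemma cov_prod_noninj n (f : 'I_n -> 'I_n) : ~~ injectiveb f -> cov_prod f = 0.
Proof.
rewrite /injectiveb /dinjectiveb enumT cov_prodE => fN.
by have [c [-> ->]] := wedge_prod_eset [seq f k | k <- Finite.enum 'I_n]; rewrite ?scale0r.
Qed.

Lemma cov_prod1 n : cov_prod id = eset finset.setT :> extform R n.
Proof.
rewrite eset_wedge_prod -wedge_prod_set; apply: eq_bigl => k; by rewrite inE.
Qed.

Definition perm_coef n (s : {perm 'I_n}) : R := cov_prod s finset.setT.

Lemma cov_prod_perm n (s : {perm 'I_n}) : cov_prod s = perm_coef s *: eset finset.setT.
Proof.
rewrite /perm_coef cov_prodE; have [c [-> _]] := wedge_prod_eset [seq s k | k <- index_enum 'I_n].
rewrite (_ : [set k in _] = finset.setT) ?ffunE ?eqxx ?[_ *: 1]mulr1 //.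
apply/finset.setP => k; rewrite !inE; apply/mapP; exists (s^-1 k)%g.
  by rewrite mem_index_enum.
by rewrite permKV.
Qed.

(** Substituting e^k by e^(t k) in the product of the e^(s k) gives the product for
    s * t, and substitution is linear. *)
Lemma perm_coefM n (s t : {perm 'I_n}) : perm_coef (s * t)%g = perm_coef s * perm_coef t.
Proof.
suff E : cov_prod (s * t)%g = perm_coef s *: cov_prod t.
  by rewrite /perm_coef E ffunE.
pose P : 'M[R]_n := \matrix_(j, k) (j == t k)%:R.
have pullP_cov k : pull P (cov k) = cov (t k).
  rewrite pull_cov -oneform_cov; congr oneform; apply/funext => j.
  by rewrite mxE.
have prodP f : pull P (cov_prod f) = cov_prod (fun k => t (f k)).
  rewrite !cov_prodE pull_wedge_prod /wedge_prod !big_map; apply: eq_bigr => k _.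
  by rewrite -pull_cov pullP_cov.
rewrite -[cov_prod t]/(cov_prod (fun k => t (id k))) -prodP cov_prod1 -[RHS]linearZ /=.
by rewrite -cov_prod_perm prodP; apply: eq_bigr => k _; rewrite permM.
Qed.

Lemma perm_coef1 n : perm_coef (1 : {perm 'I_n})%g = 1.
Proof.
rewrite /perm_coef (_ : cov_prod _ = cov_prod id); first by rewrite cov_prod1 ffunE eqxx.
by apply: eq_bigr => k _; rewrite perm1.
Qed.

(** All transpositions are conjugate and the coefficient is a character with
    values in a commutative ring, so it suffices to exchange the first two
    factors. *)
Lemma perm_coef_tperm n (i j : 'I_n) : i != j -> perm_coef (tperm i j) = -1.
Proof.
case: n i j => [[]//|[[[|//] ?] [[|//] ?] /eqP[]|n i j ij]]; first exact: val_inj.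
pose i0 : 'I_n.+2 := ord0; pose i1 : 'I_n.+2 := lift ord0 ord0.
have eps01 : perm_coef (tperm i0 i1) = -1.
  suff E : cov_prod (tperm i0 i1) = - cov_prod (1 : {perm 'I_n.+2})%g.
    by rewrite /perm_coef E ffunE -/(perm_coef _) perm_coef1.
  rewrite /cov_prod 2!big_ord_recl [in RHS]big_ord_recl [in RHS]big_ord_recl.
  rewrite tpermL tpermR !perm1 !wedgeA wedge_covC wedgeNl.
  congr (- wedge _ _); apply: eq_bigr => k _; rewrite perm1 tpermD //.
have [s [si sj]] : exists s : {perm 'I_n.+2}, s i = i0 /\ s j = i1.
  have j0 : tperm i i0 j != i0 by rewrite -[X in _ != X](tpermL i i0) (inj_eq perm_inj) eq_sym.
  exists (tperm i i0 * tperm (tperm i i0 j) i1)%g; split; rewrite permM tpermL //.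
  exact: tpermD.
rewrite -eps01 -si -sj -tpermJ conjgE !perm_coefM mulrCA -perm_coefM.
by rewrite mulVg perm_coef1 mulr1.
Qed.

Lemma perm_coef_sign n (s : {perm 'I_n}) : perm_coef s = (-1) ^+ s.
Proof.
have [ts -> dts] := prod_tpermP s.
rewrite odd_perm_prod // signr_odd; elim: ts dts => [|t ts IH] /=.
  by rewrite big_nil perm_coef1.
by case/andP=> dt dts; rewrite big_cons perm_coefM perm_coef_tperm // IH // exprS.
Qed.

(** Expanding the product of the n images of covectors gives the Leibniz formula. *)
Lemma pull_top n (M : 'M[R]_n) : pull M (eset finset.setT) = \det M *: eset finset.setT.
Proof.
rewrite pull_eset (eq_bigl predT) => [|k]; last by rewrite inE.
rewrite /oneform wedge_distr /=.
have termE (f : 'I_n -> 'I_n) : \big[wedge/ext_one]_k (M (f k) k *: cov (f k)) =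
    (\prod_k M (f k) k) *: cov_prod f.
  exact: (wedge_prod_scale (fun k => M (f k) k) (fun k => cov (f k))).
under eq_bigr do rewrite termE.
rewrite (bigID (fun f : {ffun 'I_n -> 'I_n} => injectiveb f)) /=.
rewrite [X in _ + X]big1 ?addr0; last first.
  by move=> f fN; rewrite cov_prod_noninj ?scaler0.
rewrite -det_tr /determinant scaler_suml.
rewrite (reindex (fun s : {perm 'I_n} => pval s)) /=; last first.
  have perm0 : {perm 'I_n} := 1%g.
  exists (fun f => insubd perm0 f) => [s _|f /= fi]; first exact: valKd.
  by rewrite (insubdK perm0 fi).
apply: eq_big => [s|s _]; first exact: (valP s).
have -> : cov_prod (pval s) = perm_coef s *: eset finset.setT.
  by rewrite -cov_prod_perm; apply: eq_bigr => k _; rewrite pvalE.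
rewrite perm_coef_sign scalerA mulrC; congr (_ * _ *: _).
by apply: eq_bigr => k _; rewrite mxE pvalE.
Qed.

End Determinant.

(** * Naturality of the Hodge star *)

Section Hodge.
Context {R : realType} {n : nat}.
Implicit Types (a b : extform R n) (S T U : {set 'I_n}) (M g : 'M[R]_n).
Local Notation top := (eset finset.setT : extform R n).

(** Wedging with e^(~: S) reads off the coefficient on e^S up to sign. *)
Lemma wedge_top_nondeg a b :
  (forall c, wedge c a finset.setT = wedge c b finset.setT) -> a = b.
Proof.
move=> ab; apply/ffunP => S.
have wS c : wedge (eset (~: S)) c finset.setT = (-1) ^+ inversions (~: S) S * c S.
  rewrite !ffunE (bigD1 (~: S)) ?inE ?finset.subsetT //= big1.
    by rewrite finset.setTD finset.setCK !ffunE eqxx mul1r addr0.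
  by move=> T /andP[_ TS]; rewrite ffunE (negPf TS) mul0r mulr0.
have := ab (eset (~: S)); rewrite !wS; apply: mulfI.
by rewrite expf_eq0 oppr_eq0 oner_eq0 andbF.
Qed.

Lemma det_gt0_unitmx M : 0 < \det M -> M \in unitmx.
Proof. by move=> detM; rewrite unitmxE unitfE gt_eqF. Qed.

Lemma hodge_linear g : linear (@hodge R n g).
Proof.
move=> x a b; apply/ffunP => U; rewrite !ffunE pull_linear !ffunE /GRing.scale /=.
by ring.
Qed.

HB.instance Definition _ g :=
  GRing.isLinear.Build R (extform R n) (extform R n) _ (hodge g) (hodge_linear g).

Lemma hodge_euclid g b :
  hodge g b = Num.sqrt (\det g) *: hodge 1%:M (pull (invmx g) b).
Proof.
by apply/ffunP => U; rewrite !ffunE det1 sqrtr1 mul1r invmx1 pull_id.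
Qed.

Lemma hodge1P a b : wedge a (hodge 1%:M b) finset.setT = pairing a b.
Proof.
rewrite hodgeP /form_inner invmx1 pull_id !ffunE det1 sqrtr1 eqxx !mulr1.
by rewrite [_ *: _]mulr1.
Qed.

Lemma top_coef M a : pull M a finset.setT = \det M * a finset.setT.
Proof.
rewrite -pairing_eset pairingC pairing_pull pull_top det_tr pairingC pairingZl.
by rewrite pairing_eset.
Qed.

(** The Euclidean star is determined by [hodge1P]; the substitution by the inverse
    transpose preserves the pairing with [pull M] by [pairing_pull], and scales the
    top degree by the inverse of the determinant. *)
Lemma hodge_pull1 M b : M \in unitmx ->
  hodge 1%:M (pull M b) = \det M *: pull (invmx M)^T (hodge 1%:M b).
Proof.
move=> uM; apply: wedge_top_nondeg => c.
have LM : (invmx M)^T *m M^T = 1%:M by rewrite -trmx_mul mulmxV // trmx1.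
have -> : c = pull (invmx M)^T (pull M^T c) by rewrite -pull_mul LM pull_id.
move: (pull M^T c) => {}c.
rewrite hodge1P pairing_pull trmxK -pull_mul mulVmx // pull_id.
rewrite wedgeZr -pull_wedge [RHS]ffunE top_coef hodge1P det_tr det_inv.
have detM : \det M != 0 by rewrite -unitfE -unitmxE.
by rewrite [RHS]mulrA divff ?mul1r.
Qed.

(** The isometry from the Euclidean metric to M *m M^T transports the star. *)
Lemma hodge_pull M b : 0 < \det M ->
  hodge (M *m M^T) (pull M b) = pull M (hodge 1%:M b).
Proof.
move=> detM; have uM := det_gt0_unitmx detM.
have uMT : M^T \in unitmx by rewrite unitmx_tr.
rewrite hodge_euclid det_mulmx det_tr -expr2 sqrtr_sqr gtr0_norm // -pull_mul.
rewrite (_ : invmx (M *m M^T) *m M = invmx M^T); last first.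
  have uMM : M *m M^T \in unitmx by rewrite unitmx_mul uM.
  by apply: (can_inj (mulKmx uMM)); rewrite mulKVmx // -mulmxA mulmxV // mulmx1.
rewrite hodge_pull1 ?unitmx_inv // invmxK trmxK scalerA det_inv det_tr.
by rewrite divff ?gt_eqF // scale1r.
Qed.

Lemma volE g : vol g = Num.sqrt (\det g) *: top.
Proof. by apply/ffunP => U; rewrite !ffunE. Qed.

End Hodge.

(** * The metric of a G2-structure *)

Section Metric.
Context {R : realType}.
Implicit Types (phi psi : extform R 7) (M g : 'M[R]_7).

(** The metric equation for the standard metric and volume. *)
Definition euclidean phi := forall x y : 'rV[R]_7,
  wedge (wedge (interior_prod x phi) (interior_prod y phi)) phi =
  (6 * (x *m y^T) 0 0) *: eset finset.setT.

Lemma euclidean_pull phi M x y : euclidean phi ->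
  wedge (wedge (interior_prod x (pull M phi)) (interior_prod y (pull M phi)))
    (pull M phi) = (6 * (\det M * (x *m (M *m M^T) *m y^T) 0 0)) *: eset finset.setT.
Proof.
move=> eu; rewrite !interior_pull -!pull_wedge eu linearZ /= pull_top scalerA.
congr (_ *: _); rewrite -!mulrA; congr (_ * _); rewrite mulrC; congr (_ * _).
by rewrite trmx_mul !mulmxA.
Qed.

(** M *m M^T is the pulled back metric.  For uniqueness, any other solution g of
    the metric equation satisfies sqrt(det g) g = det M (M *m M^T); comparing
    determinants gives sqrt(det g)^9 = (det M)^9, hence sqrt(det g) = det M. *)
Lemma metric_pull phi M : euclidean phi -> 0 < \det M ->
  metric_of (pull M phi) = M *m M^T.
Proof.
move=> eu detM.
have uM := det_gt0_unitmx detM.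
have isM : is_metric_of (pull M phi) (M *m M^T).
  split=> [|v v0|x y]; first by rewrite trmx_mul trmxK.
    rewrite mulmxA -mulmxA -trmx_mul.
    have : v *m M != 0.
      by apply: contraNneq v0 => vM0; rewrite -(mulmxK uM v) vM0 mul0mx.
    move: (v *m M) => w /rV0Pn[j wj]; rewrite mxE (bigD1 j) //= mxE -expr2.
    rewrite ltr_pwDl ?exprn_even_gt0 // sumr_ge0 // => k _; rewrite mxE -expr2.
    exact: sqr_ge0.
  rewrite euclidean_pull // volE scalerA; congr (_ *: _).
  rewrite det_mulmx det_tr -expr2 sqrtr_sqr gtr0_norm //; ring.
rewrite /metric_of; case: xgetP => [g _ isg|/(_ _ isM)//].
have [_ _ gE] := isg.
have {}gE : Num.sqrt (\det g) *: g = \det M *: (M *m M^T).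
  apply/matrixP => i j; have := gE (delta_mx 0 i) (delta_mx 0 j).
  rewrite euclidean_pull // volE scalerA => /eqP.
  rewrite -subr_eq0 -scalerBl scaler_eq0 (negPf (eset_neq0 _)) orbF subr_eq0 => /eqP.
  rewrite trmx_delta -!rowE -!colE !mxE => E.
  by apply: (@mulfI _ 6); rewrite ?pnatr_eq0 // -E; ring.
have := congr1 determinant gE; rewrite !detZ det_mulmx det_tr => detE.
have sg0 : Num.sqrt (\det g) != 0.
  apply: contraTneq detM => sg; move/eqP: detE; rewrite sg expr0n mul0r eq_sym.
  by rewrite -expr2 -exprD expf_eq0 /= => /eqP->; rewrite ltxx.
have dg : \det g = Num.sqrt (\det g) ^+ 2.
  by rewrite sqr_sqrtr // leNgt; apply: contraNN sg0 => /ltW/ler0_sqrtr ->.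
move: gE; have -> : Num.sqrt (\det g) = \det M.
  apply: (@pexpIrn _ 9); rewrite ?nnegrE ?sqrtr_ge0 ?(ltW detM) //.
  by move: detE; rewrite {2}dg -!exprD -expr2 -exprD.
by apply: scalerI; rewrite gt_eqF.
Qed.

End Metric.

(** * A G2-structure is determined by its dual form *)

Section Duality.
Context {R : realType}.
Implicit Types (phi psi : extform R 7) (M N : 'M[R]_7).

Lemma star_pull phi M : euclidean phi -> 0 < \det M ->
  star (pull M phi) (pull M phi) = pull M (hodge 1%:M phi).
Proof. by move=> eu detM; rewrite /star metric_pull // hodge_pull. Qed.

(** Let L be the inverse transpose of M and d = det M.  Applying the star to
    M^* psi = psi gives L^* phi = d^-1 phi.  The metric equation is cubic in phi, so
    L *m L^T = d^-2; taking determinants, d^12 = 1.  Thus d = 1, M is orthogonal,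
    and M = L fixes phi. *)
Lemma stabilizer_of_dual phi M : euclidean phi -> hodge 1%:M (hodge 1%:M phi) = phi ->
  0 < \det M -> pull M (hodge 1%:M phi) = hodge 1%:M phi -> pull M phi = phi.
Proof.
move=> eu phiK detM; set psi := hodge 1%:M phi in phiK * => Mpsi.
have uM := det_gt0_unitmx detM.
set L := (invmx M)^T; set d := \det M in detM.
have d0 : d != 0 by rewrite gt_eqF.
have detL : \det L = d^-1 by rewrite det_tr det_inv.
have Lphi : pull L phi = d^-1 *: phi.
  have := hodge_pull1 psi uM; rewrite Mpsi phiK -/L -/d => {2}->.
  by rewrite scalerA mulVf // scale1r.
have LL : L *m L^T = (d ^- 2)%:M.
  apply/matrixP => i j.
  have := euclidean_pull L (delta_mx 0 i) (delta_mx 0 j) eu.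
  rewrite Lphi !linearZ /= !(wedgeZl, wedgeZr) eu !scalerA detL => /eqP.
  rewrite -subr_eq0 -scalerBl scaler_eq0 (negPf (eset_neq0 _)) orbF subr_eq0 => /eqP.
  rewrite trmx_delta -!rowE -!colE !mxE => E.
  apply: (@mulfI _ (6 * d^-1)); first by rewrite mulf_neq0 ?invr_eq0 ?pnatr_eq0.
  rewrite -[LHS]mulrA -E eqxx /=; case: (i == j); rewrite ?mulr1n ?mulr0n; first by field.
  by ring.
have d1 : d = 1.
  have := congr1 determinant LL; rewrite det_mulmx [\det L^T]det_tr detL det_scalar => dE.
  apply: (@pexpIrn _ 12); rewrite ?nnegrE ?(ltW detM) // expr1n.
  have -> : d ^+ 12 = d ^+ 14 * (d^-1 * d^-1) by field.
  by rewrite dE; field.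
rewrite d1 expr1n invr1 in LL.
suff -> : M = L by rewrite Lphi d1 invr1 scale1r.
have := mulmx1C LL; rewrite trmxK => LM.
by rewrite -[LHS]mulmx1 -LM mulmxA mulmxV // mul1mx.
Qed.

(** Two positive forms lie in one orbit, so phi' is a pullback M^* phi.  If its dual
    is N^* psi, then N^-1 M stabilizes psi, hence phi. *)
Lemma dual_unique phi M0 N : euclidean phi -> hodge 1%:M (hodge 1%:M phi) = phi ->
  0 < \det M0 -> phi = pull M0 phi_std -> 0 < \det N ->
  forall phi', is_dual (pull N (hodge 1%:M phi)) phi' <-> phi' = pull N phi.
Proof.
move=> eu phiK detM0 phiE detN phi'.
have uN := det_gt0_unitmx detN.
have uM0 := det_gt0_unitmx detM0.
split=> [[[M' [detM' ->]]]|->]; last first.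
  split; last exact: star_pull.
  by exists (N *m M0); rewrite det_mulmx mulr_gt0 // pull_mul -phiE.
have -> : pull M' phi_std = pull (M' *m invmx M0) phi.
  by rewrite phiE -pull_mul mulmxKV.
have : 0 < \det (M' *m invmx M0) by rewrite det_mulmx det_inv divr_gt0.
move: (M' *m _) => M detM; rewrite star_pull // => MN.
have : pull (invmx N *m M) phi = phi.
  apply: stabilizer_of_dual => //; first by rewrite det_mulmx det_inv mulrC divr_gt0.
  by rewrite pull_mul MN -pull_mul mulVmx // pull_id.
by move=> {2}<-; rewrite -pull_mul mulKVmx.
Qed.

Lemma G2_of_pull phi M0 N : euclidean phi -> hodge 1%:M (hodge 1%:M phi) = phi ->
  0 < \det M0 -> phi = pull M0 phi_std -> 0 < \det N ->
  G2_of (pull N (hodge 1%:M phi)) = pull N phi.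
Proof.
move=> eu phiK detM0 phiE detN.
have dualP := dual_unique eu phiK detM0 phiE detN.
rewrite /G2_of; case: xgetP => [phi' _ /dualP//|/(_ (pull N phi)) []].
exact/dualP.
Qed.

End Duality.

(** * Computing with integral forms on R^7 *)

Section Calculator.
Context {R : realType}.
Local Notation e := (@e R).

(** A formal integral combination of products e^(i_1) /\ ... /\ e^(i_k) of covectors
    in any order.  The operations below act on such lists by computation; the suffix
    M marks operations on one monomial, L those on combinations, and the lemma of
    the same name with a final P states the agreement with the operation on forms. *)
Definition lform := seq (int * seq nat).

Definition interp (l : lform) : extform R 7 := \sum_(p <- l) p.1%:~R *: e p.2.

(** Covectors are numbered from 1 in monomials. *)
Definition idx (i : nat) : 'I_7 := inord i.-1.

Lemma e_cat s t : e (s ++ t) = wedge (e s) (e t).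
Proof. exact: wedge_prod_cat. Qed.

Lemma e_cons i s : e (i :: s) = wedge (cov (idx i)) (e s).
Proof. exact: wedge_prod_cons. Qed.

Lemma interp_cons p l : interp (p :: l) = p.1%:~R *: e p.2 + interp l.
Proof. exact: big_cons. Qed.

Lemma interp_nil : interp [::] = 0.
Proof. exact: big_nil. Qed.

Lemma interp_cat l m : interp (l ++ m) = interp l + interp m.
Proof. exact: big_cat. Qed.

Lemma interp_flatten (ls : seq lform) :
  interp (flatten ls) = \sum_(l <- ls) interp l.
Proof. by rewrite /interp big_flatten. Qed.

Definition scaleL (c : int) (l : lform) : lform := [seq (c * p.1, p.2) | p <- l].

Lemma scaleLP c l : interp (scaleL c l) = c%:~R *: interp l.
Proof.
rewrite /interp big_map scaler_sumr; apply: eq_bigr => p _ /=.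
by rewrite scalerA intrM.
Qed.

Definition wedgeL (l m : lform) : lform :=
  [seq (p.1 * q.1, p.2 ++ q.2) | p <- l, q <- m].

Lemma wedgeLP l m : interp (wedgeL l m) = wedge (interp l) (interp m).
Proof.
rewrite /interp /wedgeL big_allpairs_dep wedge_suml; apply: eq_bigr => p _.
rewrite wedge_sumr; apply: eq_bigr => q _ /=.
by rewrite wedgeZl wedgeZr scalerA intrM e_cat.
Qed.

Fixpoint contractM (k : nat) (s : seq nat) : lform :=
  if s is i :: t then
    nseq (i == k) (1, t) ++ [seq (- p.1, i :: p.2) | p <- contractM k t]
  else [::].

Definition in7 (i : nat) := (0 < i <= 7)%N.

Lemma idx_eq i k : in7 i -> in7 k -> (idx i == idx k) = (i == k).
Proof.
case: i k => [|i] [|k] //= i7 k7.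
by rewrite /idx -val_eqE /= !inordK.
Qed.

Lemma contractMP k s : in7 k -> all in7 s ->
  contract_basis (idx k) (e s) = interp (contractM k s).
Proof.
move=> k7; elim: s => [_|i s IH /= /andP[i7 s7]].
  by rewrite interp_nil /Defs.e big_nil contract_one.
rewrite e_cons contract_wedge_cov IH // interp_cat; congr (_ + _).
  rewrite idx_eq //; case: eqP => _; rewrite ?interp_nil ?scale0r //.
  by rewrite interp_cons interp_nil addr0.
rewrite /interp big_map wedge_sumr -sumrN; apply: eq_bigr => p _ /=.
by rewrite wedgeZr e_cons mulrNz scaleNr.
Qed.

Definition wf (l : lform) := all (fun p => all in7 p.2) l.

Definition contractL k (l : lform) : lform :=
  flatten [seq scaleL p.1 (contractM k p.2) | p <- l].

Lemma contractLP k l : in7 k -> wf l ->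
  contract_basis (idx k) (interp l) = interp (contractL k l).
Proof.
move=> k7 /allP wfl; rewrite /interp linear_sum -/(interp _) interp_flatten big_map.
rewrite big_seq [RHS]big_seq; apply: eq_bigr => p /wfl p7.
by rewrite linearZ /= contractMP // scaleLP.
Qed.

(** The sign and the sorted list obtained by moving i into place; the coefficient 0
    records a repeated covector. *)
Fixpoint insertM (i : nat) (s : seq nat) : int * seq nat :=
  if s is j :: t then
    if (i < j)%N then (1, i :: s)
    else if i == j then (0, [::])
    else let p := insertM i t in (- p.1, j :: p.2)
  else (1, [:: i]).

Definition sortM (s : seq nat) : int * seq nat :=
  foldr (fun i p => let q := insertM i p.2 in (p.1 * q.1, q.2)) (1, [::]) s.

Lemma insertMP i s : e (i :: s) = (insertM i s).1%:~R *: e (insertM i s).2.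
Proof.
elim: s => [|j s IH] /=; first by rewrite scale1r.
case: ifP => _; first by rewrite scale1r.
case: eqP => [->|_] /=.
  by rewrite scale0r !e_cons wedgeA (anti_eq0 (wedge_covC _ _)) wedge0l.
rewrite !e_cons wedgeA wedge_covC wedgeNl -wedgeA -(e_cons i) IH wedgeZr.
by rewrite -scaleNr mulrNz.
Qed.

Lemma sortMP s : e s = (sortM s).1%:~R *: e (sortM s).2.
Proof.
elim: s => [|i s IH] /=; first by rewrite scale1r.
by rewrite e_cons IH wedgeZr -e_cons insertMP scalerA intrM.
Qed.

Fixpoint addM (p : int * seq nat) (l : lform) : lform :=
  if l is q :: l' then
    if p.2 == q.2 then (p.1 + q.1, q.2) :: l' else q :: addM p l'
  else [:: p].

Lemma addMP p l : interp (addM p l) = p.1%:~R *: e p.2 + interp l.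
Proof.
elim: l => [|q l IH] /=; first by rewrite interp_cons.
case: eqP => [->|_]; rewrite !interp_cons /=; first by rewrite intrD scalerDl addrA.
by rewrite IH addrCA.
Qed.

Definition normL (l : lform) : lform :=
  foldr (fun p m => let q := sortM p.2 in addM (p.1 * q.1, q.2) m) [::] l.

Lemma normLP l : interp l = interp (normL l).
Proof.
elim: l => [//|p l IH]; rewrite interp_cons /= addMP IH; congr (_ + _).
by rewrite sortMP scalerA intrM.
Qed.

Definition eqL (l m : lform) :=
  all (fun p => p.1 == 0) (normL (l ++ scaleL (-1) m)).

Lemma eqLP l m : eqL l m -> interp l = interp m.
Proof.
move=> /allP lm; apply/eqP; rewrite -subr_eq0; apply/eqP.
transitivity (interp (l ++ scaleL (-1) m)).
  by rewrite interp_cat scaleLP scaleN1r.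
rewrite normLP /interp big_seq big1 // => p /lm /eqP ->.
by rewrite scale0r.
Qed.

Definition full : seq nat := iota 1 7.
Definition complM (s : seq nat) := [seq i <- full | i \notin s].
(** The sign of *e^S is that of e^S /\ e^(~: S), which sorting computes. *)
Definition hodgeM (s : seq nat) : int * seq nat :=
  ((sortM (s ++ complM s)).1, complM s).
Definition hodgeable (s : seq nat) :=
  [&& sorted ltn s, all in7 s & (sortM (s ++ complM s)).2 == full].

Lemma mem_idx s (k : 'I_7) : all in7 s -> (k \in map idx s) = (k.+1 \in s).
Proof.
move=> /allP s7; apply/mapP/idP => [[i /[dup] is_ /s7]|ks].
  by case: i is_ => // i is_ i7 ->; rewrite /idx inordK.
by exists k.+1; rewrite // /idx /= inord_val.
Qed.

Lemma e_eset s : sorted ltn s -> all in7 s -> e s = eset [set k : 'I_7 | k.+1 \in s].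
Proof.
move=> ss s7; have -> : e s = wedge_prod cov (map idx s) by rewrite /wedge_prod big_map.
rewrite increasing_eset.
  by congr eset; apply/finset.setP => k; rewrite !inE mem_idx.
rewrite /increasing sorted_map; apply: (sub_in_sorted _ s7 ss) => i j.
case: i => // i; case: j => // j i7 j7.
by rewrite /idx /= !inordK.
Qed.

Lemma mem_full (k : 'I_7) : k.+1 \in full.
Proof. by rewrite mem_iota add1n [(k.+1 < 8)%N]ltnS ltn_ord. Qed.

Lemma full_in7 k : k \in full -> in7 k.
Proof. by rewrite mem_iota. Qed.

Lemma e_full : e full = eset finset.setT.
Proof.
rewrite e_eset //; congr eset; apply/finset.setP => k.
by rewrite finset.in_set finset.in_setT mem_full.
Qed.

Lemma hodgeMP s : hodgeable s ->
  hodge 1%:M (e s) = (hodgeM s).1%:~R *: e (hodgeM s).2.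
Proof.
case/and3P=> ss s7 /eqP sc.
have cE : e (complM s) = eset (~: [set k : 'I_7 | k.+1 \in s]).
  have sc' : sorted ltn (complM s) by apply: sorted_filter => //; exact: ltn_trans.
  rewrite (e_eset sc'); last by apply/allP => i; rewrite mem_filter mem_iota => /andP[].
  congr eset; apply/finset.setP => k; by rewrite !finset.in_set mem_filter mem_full andbT.
rewrite /= cE [in LHS]e_eset //; set S := [set k : 'I_7 | _] in cE *.
have sgn : (-1) ^+ inversions S (~: S) = (sortM (s ++ complM s)).1%:~R :> R.
  have := sortMP (s ++ complM s); rewrite sc e_full e_cat cE e_eset // -/S.
  rewrite wedge_eset finset.setICr eqxx finset.setUCr => /ffunP/(_ finset.setT).
  by rewrite !ffunE eqxx ![_ *: _]mulr1.
apply/ffunP => U; rewrite !ffunE det1 sqrtr1 mul1r invmx1 pull_id ffunE.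
rewrite -sgn (can2_eq (@finset.setCK _) (@finset.setCK _)).
by case: eqP => [->|_]; rewrite ?mulr0 ?scaler0 // finset.setCK [RHS]mulr1 mulr1.
Qed.

Definition hodgeL (l : lform) : lform :=
  [seq let q := hodgeM p.2 in (p.1 * q.1, q.2) | p <- l].

Lemma hodgeLP l : all (fun p => hodgeable p.2) l ->
  hodge 1%:M (interp l) = interp (hodgeL l).
Proof.
move=> /allP hl; rewrite /interp big_map linear_sum big_seq [RHS]big_seq.
apply: eq_bigr => p /hl hp; rewrite linearZ /= hodgeMP // scalerA intrM.
by [].
Qed.

Definition mono (s : seq nat) : lform := [:: (1, s)].

Definition dcovL (k : nat) : lform :=
  match k with
  | 1 => mono [:: 6; 7] | 6 => mono [:: 1; 7]
  | 3 => mono [:: 4; 7] | 4 => mono [:: 3; 7]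
  | _ => [::]
  end%N.

Lemma sum_ord7 (V : nmodType) (F : 'I_7 -> V) :
  \sum_k F k = \sum_(k <- full) F (idx k).
Proof.
rewrite (_ : full = [seq (val i).+1 | i <- enum 'I_7]); last first.
  by rewrite (map_comp succn val) val_enum_ord.
by rewrite big_map big_enum; apply: eq_bigr => k _; rewrite /idx inord_val.
Qed.

(** All brackets of basis vectors vanish except those with e_7. *)
Lemma dcovE (k : 'I_7) :
  dcov bracket k = \sum_i adA i k *: wedge (cov i) (cov ord_max) :> extform R 7.
Proof.
have brE (i j : 'I_7) : bracket (delta_mx 0 i) (delta_mx 0 j) 0 k =
    (i == ord_max)%:R * adA j k - (j == ord_max)%:R * adA i k :> R.
  rewrite /bracket -!rowE !mxE eqxx /=.
  by rewrite ![ord_max == _]eq_sym.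
have A7 : adA ord_max k = 0 :> R by rewrite mxE.
rewrite /dcov -sumrN; apply: eq_bigr => i _.
have [->|i7] := eqVneq i ord_max.
  by rewrite A7 scale0r big_pred0 ?oppr0 // => j; rewrite ltnNge -ltnS ltn_ord.
rewrite (bigD1 ord_max) /=; last by rewrite ltn_neqAle -ltnS ltn_ord andbT.
rewrite big1 => [|j /andP[_ /negPf j7]].
  by rewrite addr0 brE eqxx (negPf i7) mul0r sub0r mul1r scaleNr opprK.
by rewrite brE j7 (negPf i7) !mul0r subr0 scale0r.
Qed.

Lemma dcovLP k : in7 k -> dcov bracket (idx k) = interp (dcovL k).
Proof.
move=> k7; rewrite dcovE sum_ord7.
have adAE i : in7 i ->
    adA (idx i) (idx k) = ((i, k) \in [:: (1, 6); (6, 1); (3, 4); (4, 3)]%N)%:R :> R.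
  by case: i k k7 => [|i] [|k] // k7 i7; rewrite mxE !inordK.
have -> : ord_max = idx 7 by apply: val_inj; rewrite /= inordK.
rewrite big_seq; under eq_bigr => i i7.
  rewrite adAE; last by rewrite mem_iota in i7.
  over.
rewrite -big_seq /full /=.
have eE2 i j : wedge (cov (idx i)) (cov (idx j)) = e [:: i; j].
  by rewrite e_cons e_cons /Defs.e big_nil wedge1r.
by move: k k7 {adAE} => [|[|[|[|[|[|[|[|k]]]]]]]] // _;
  rewrite !big_cons big_nil /= ?scale0r ?scale1r ?addr0 ?add0r ?interp_nil
             ?interp_cons ?interp_nil ?addr0 ?scale1r ?eE2.
Qed.

Definition dL (l : lform) : lform :=
  flatten [seq wedgeL (dcovL k) (contractL k l) | k <- full].

Lemma CE_d_linear br : linear (@CE_d R 7 br).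
Proof.
move=> x a b; rewrite /CE_d scaler_sumr -big_split; apply: eq_bigr => k _ /=.
by rewrite contract_linear wedgeDr wedgeZr.
Qed.

HB.instance Definition _ br :=
  GRing.isLinear.Build R (extform R 7) (extform R 7) _ (CE_d br) (CE_d_linear br).

Lemma dLP l : wf l -> CE_d bracket (interp l) = interp (dL l).
Proof.
move=> wfl; rewrite /CE_d sum_ord7 interp_flatten big_map big_seq [RHS]big_seq.
apply: eq_bigr => k; rewrite mem_iota => k7.
by rewrite dcovLP // contractLP // wedgeLP.
Qed.

(** The metric equation on pairs of basis vectors. *)
Definition euclideanL (l : lform) : bool :=
  all (fun i => all (fun j =>
    eqL (wedgeL (wedgeL (contractL i l) (contractL j l)) l)
        (if i == j then [:: (6, full)] else [::])) full) full.

Lemma euclideanLP l : wf l -> euclideanL l -> euclidean (interp l).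
Proof.
move=> wfl eul x y.
rewrite /interior_prod !sum_ord7 wedge_suml wedge_suml.
have -> : (x *m y^T) 0 0 = \sum_(i <- full) x 0 (idx i) * y 0 (idx i).
  by rewrite mxE sum_ord7; apply: eq_bigr => i _; rewrite mxE.
rewrite mulr_sumr scaler_suml big_seq [RHS]big_seq; apply: eq_bigr => i i7.
rewrite [X in wedge X _]wedge_sumr [LHS]wedge_suml.
under eq_bigr do rewrite !(wedgeZl, wedgeZr) scalerA.
rewrite (bigD1_seq i) ?iota_uniq //=.
have wedgeE k : k \in full -> wedge (wedge (contract_basis (idx i) (interp l))
    (contract_basis (idx k) (interp l))) (interp l) =
    if i == k then 6 *: eset finset.setT else 0.
  move=> k7; rewrite !contractLP ?full_in7 // -!wedgeLP.
  move/allP: eul => /(_ _ i7) /allP /(_ _ k7) /eqLP ->.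
  by case: eqP => _; rewrite ?interp_nil // interp_cons interp_nil addr0 e_full.
rewrite wedgeE // eqxx scalerA big_seq_cond big1 => [|k /andP[k7 ki]].
  by rewrite addr0; congr (_ *: _); ring.
by rewrite wedgeE // eq_sym (negPf ki) scaler0.
Qed.

Lemma pull_monomial M (c : nat -> R) (sigma : nat -> nat) s :
  (forall i, i \in s -> pull M (cov (idx i)) = c i *: cov (idx (sigma i))) ->
  pull M (e s) = (\prod_(i <- s) c i) *: e [seq sigma i | i <- s].
Proof.
elim: s => [|i s IH] Ms; first by rewrite /Defs.e !big_nil pull1form scale1r.
rewrite !e_cons pull_wedge Ms ?mem_head // IH => [|j js]; last first.
  by apply: Ms; rewrite inE js orbT.
by rewrite wedgeZl wedgeZr scalerA big_cons.
Qed.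

Lemma pull_diag (v : 'rV[R]_7) s :
  pull (diag_mx v) (e s) = (\prod_(i <- s) v 0 (idx i)) *: e s.
Proof.
rewrite (@pull_monomial _ (fun i => v 0 (idx i)) id) ?map_id // => i _.
exact: pull_diag_cov.
Qed.

End Calculator.

(** * Exponentials, derivatives and automorphisms of the group *)

Section Analysis.
Context {R : realType}.

Lemma iter_diag n (v : 'rV[R]_n) k :
  iter k (mulmx (diag_mx v)) 1%:M = diag_mx (\row_j v 0 j ^+ k).
Proof.
elim: k => [|k IH] /=.
  rewrite -diag_const_mx; congr diag_mx; apply/rowP => j; rewrite !mxE.
  by rewrite expr0.
rewrite IH mulmx_diag; congr diag_mx; apply/rowP => j; rewrite !mxE.
by rewrite exprS.
Qed.

Lemma expM_diag n (v : 'rV[R]_n) : expM (diag_mx v) = diag_mx (map_mx expR v).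
Proof.
apply/matrixP => i j; rewrite !mxE.
have [<-|neqij] := eqVneq i j.
  rewrite mulr1n /expR; congr (limn (series _)); apply/funext => k.
  by rewrite iter_diag !mxE eqxx mulr1n.
rewrite mulr0n (_ : series _ = fun=> 0) ?lim_cst //.
apply/funext => k; rewrite /series /= big1 // => l _.
by rewrite iter_diag !mxE (negPf neqij) mulr0n mul0r.
Qed.

(** If v_i and v_j differ, then the entry (i, j) of every power of X is zero, and
    so is that of every partial sum of the exponential series. *)
Lemma expM_comm_diag n (v : 'rV[R]_n) (X : 'M[R]_n) :
  diag_mx v *m X = X *m diag_mx v ->
  diag_mx v *m expM X = expM X *m diag_mx v.
Proof.
move=> vX; apply/matrixP => i j; rewrite mul_diag_mx mul_mx_diag !mxE mulrC.
have [->//|vij] := eqVneq (v 0 i) (v 0 j).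
suff -> : limn (series (fun k => iter k (mulmx X) 1%:M i j / k`!%:R)) = 0.
  by rewrite !mul0r.
rewrite (_ : series _ = fun=> 0) ?lim_cst //.
apply/funext => k; rewrite /series /= big1 // => l _.
suff -> : iter l (mulmx X) 1%:M i j = 0 by rewrite mul0r.
have : diag_mx v *m iter l (mulmx X) 1%:M = iter l (mulmx X) 1%:M *m diag_mx v.
  elim: l => [|l IH] /=; first by rewrite mulmx1 mul1mx.
  by rewrite mulmxA vX -mulmxA IH mulmxA.
move/matrixP/(_ i j); rewrite mul_diag_mx mul_mx_diag !mxE mulrC => /eqP.
by rewrite -subr_eq0 -mulrBr mulf_eq0 subr_eq0 (negPf vij) orbF => /eqP.
Qed.

Lemma pull_diag_coef n (v : 'rV[R]_n) (a : extform R n) (S : {set 'I_n}) :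
  pull (diag_mx v) a S = (\prod_(k in S) v 0 k) * a S.
Proof.
have pull_diag_eset T :
    pull (diag_mx v) (eset T) = (\prod_(k in T) v 0 k) *: eset T.
  rewrite eset_wedge_prod pull_wedge_prod -[\prod_(k in T) _]big_enum /= -wedge_prod_scale.
  by apply: eq_bigr => k _; rewrite -pull_cov pull_diag_cov.
rewrite {1}(form_expansion a) linear_sum sum_ffunE (bigD1 S) //= big1 ?addr0.
  by rewrite linearZ /= pull_diag_eset !ffunE eqxx [X in _ *: X]mulr1 [LHS]mulrC.
by move=> T TS; rewrite linearZ /= pull_diag_eset !ffunE eq_sym (negPf TS) !scaler0.
Qed.

(** e^(t v) multiplies e^S by the exponential of t times the weight of S. *)
Lemma lie_derivative_diag n (v : 'rV[R]_n) (a : extform R n) :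
  lie_derivative (diag_mx v) a = [ffun S : {set 'I_n} => (\sum_(k in S) v 0 k) * a S].
Proof.
apply/ffunP => S; rewrite !ffunE; set w := \sum_(k in S) v 0 k.
rewrite (_ : (fun u : R => _) = (fun u : R => a S * expR (u * w))); last first.
  apply/funext => u; rewrite -linearZ /= expM_diag pull_diag_coef mulrC; congr (_ * _).
  rewrite /w mulr_sumr expR_sum; apply: eq_bigr => k _.
  by rewrite !mxE.
rewrite derive1E; set f := fun u : R => _.
have dexp : is_derive (0 : R) 1 (fun u : R => expR (u * w)) w.
  have -> : (fun u : R => expR (u * w)) = expR \o (w \*: id).
    by apply/funext => u; rewrite /= mulrC.
  have dw : is_derive (0 : R) 1 (w \*: id : R -> R) (w *: 1) by exact: is_deriveZ.
  have := is_derive1_comp (is_derive_expR _) dw.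
  by rewrite /= scaler0 expR0 mul1r [_ *: _]mulr1.
have : is_derive (0 : R) 1 f (a S * w).
  exact: is_deriveZ.
by move=> [_ ->]; rewrite mulrC.
Qed.

Lemma thetaE n (B : 'M[R]_n) (a : extform R n) : theta B a = lie_derivative (- B) a.
Proof.
rewrite /theta /lie_derivative.
have -> : (fun t => pull (expM (- t *: B)) a) = (fun t => pull (expM (t *: - B)) a).
  by apply/funext => t; rewrite (_ : - t *: B = t *: - B) // scaleNr scalerN.
by [].
Qed.

Lemma mulmxr_differentiable n m (E : 'M[R]_(n.+1, m.+1)) (p : 'rV[R]_n.+1) :
  differentiable (mulmxr E : 'rV[R]_n.+1 -> 'rV[R]_m.+1) p.
Proof.
have -> : (mulmxr E : 'rV[R]_n.+1 -> 'rV[R]_m.+1) =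
    \sum_(i < n.+1) (fun q : 'rV[R]_n.+1 => q 0 i *: row i E).
  by apply/funext => q; rewrite /= mulmx_sum_row fct_sumE.
apply: differentiable_sum => i; apply: differentiableZl.
exact: differentiable_coord.
Qed.

Lemma mulmxr_continuous n m (E : 'M[R]_(n.+1, m.+1)) :
  continuous (mulmxr E : 'rV[R]_n.+1 -> 'rV[R]_m.+1).
Proof. by move=> p; exact/differentiable_continuous/mulmxr_differentiable. Qed.

Lemma diff_affine n m (c : 'rV[R]_m.+1) (E : 'M[R]_(n.+1, m.+1)) p :
  'd (fun q : 'rV[R]_n.+1 => c + q *m E) p = mulmxr E :> (_ -> _).
Proof.
have dE : 'd (mulmxr E : 'rV[R]_n.+1 -> 'rV[R]_m.+1) p = mulmxr E :> (_ -> _).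
  exact: (@diff_lin _ _ _ (mulmxr E) p (@mulmxr_continuous _ _ E)).
have dc : 'd (cst c : 'rV[R]_n.+1 -> 'rV[R]_m.+1) p = 0 :> (_ -> _).
  exact: diff_cst.
apply: (etrans (diffD (differentiable_cst c p) (mulmxr_differentiable E p))).
apply/funext => v.
apply: (etrans (congr2 +%R (congr1 (@^~ v) dc) (congr1 (@^~ v) dE))).
exact: add0r.
Qed.

Lemma jacobian_affine n m (c : 'rV[R]_m.+1) (E : 'M[R]_(n.+1, m.+1)) p :
  jacobian (fun q : 'rV[R]_n.+1 => c + q *m E) p = E.
Proof.
rewrite /jacobian; apply/row_matrixP => i.
by rewrite !rowE mul_rV_lin1 diff_affine.
Qed.

Lemma Ck_cst k (c : 'rV[R]_7) : Ck k (fun _ : 'rV[R]_7 => c).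
Proof.
elim: k c => [|k IH] c /=; first exact: cst_continuous.
split=> [p|v]; first exact: differentiable_cst.
have -> : 'D_v (fun _ : 'rV[R]_7 => c) = (fun=> 0) :> (_ -> _); last exact: IH.
by apply/funext => p; exact: derive_cst.
Qed.

Lemma Ck_linear k (E : 'M[R]_7) : Ck k (fun p : 'rV[R]_7 => p *m E).
Proof.
case: k => [|k] /=; first exact: mulmxr_continuous.
split=> [p|v]; first exact: mulmxr_differentiable.
have -> : 'D_v (fun p : 'rV[R]_7 => p *m E) = (fun=> v *m E) :> (_ -> _); last exact: Ck_cst.
apply/funext => p; apply: (etrans (deriveE v (mulmxr_differentiable E p))).
exact: (congr1 (@^~ v) (@diff_lin _ _ _ (mulmxr E) p (@mulmxr_continuous _ _ E))).
Qed.

Lemma linear_diffeomorphism (E : 'M[R]_7) : E \in unitmx ->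
  diffeomorphism (fun p => p *m E).
Proof.
move=> uE; exists (fun p => p *m invmx E); split.
- exact: mulmxK.
- exact: mulmxKV.
- by move=> k; exact: Ck_linear.
- by move=> k; exact: Ck_linear.
Qed.

(** Left translations are affine in the coordinates of G. *)
Lemma left_invariant_formE (a : extform R 7) p :
  left_invariant_form a p = pull (expM (ginv p 0 ord_max *: adA)) a.
Proof. by rewrite /left_invariant_form jacobian_affine. Qed.

(** Fixing the last coordinate and commuting with e^(s A), the diagonal map is a
    group automorphism, so it pulls left-invariant forms back to left-invariant
    ones through its differential at the identity. *)
Lemma pull_form_automorphism (v : 'rV[R]_7) (a : extform R 7) p :
  diag_mx v *m adA = adA *m diag_mx v -> v 0 ord_max = 1 ->
  pull_form (fun q => q *m diag_mx v) (left_invariant_form a) p =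
  left_invariant_form (pull (diag_mx v) a) p.
Proof.
move=> vA v7.
have diag7 (q : 'rV[R]_7) : (q *m diag_mx v) 0 ord_max = q 0 ord_max.
  by rewrite mul_mx_diag mxE v7 mulr1.
have comm s : diag_mx v *m expM (s *: adA) = expM (s *: adA) *m diag_mx v.
  by apply: expM_comm_diag; rewrite -scalemxAr vA scalemxAl.
rewrite /pull_form !left_invariant_formE.
have -> : ginv (p *m diag_mx v) 0 ord_max = ginv p 0 ord_max.
  by rewrite /ginv diag7 -mulmxA comm mulmxA -mulNmx diag7.
have -> : jacobian (fun q => q *m diag_mx v) p = diag_mx v.
  rewrite -[RHS](jacobian_affine 0 (diag_mx v) p); congr jacobian.
  by apply/funext => q; rewrite add0r.
by rewrite -!pull_mul comm.
Qed.

End Analysis.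

(** * The soliton and its flow *)

Section Example.
Context {R : realType}.
Local Notation e := (@e R).
Local Notation interp := (@interp R).

Definition vrow (l : seq R) : 'rV[R]_7 := \row_i nth 0 l i.

Lemma vrow_idx l i : in7 i -> vrow l 0 (idx i) = nth 0 l i.-1.
Proof. by case: i => // i i7; rewrite mxE /idx inordK. Qed.

Lemma e_degree s (S : {set 'I_7}) : #|S| != size s -> e s S = 0.
Proof.
have -> : e s = wedge_prod cov (map idx s) by rewrite /wedge_prod big_map.
have [c [-> c0]] := @wedge_prod_eset R 7 (map idx s); rewrite !ffunE.
have [->|_] := eqVneq S [set k in map idx s]; last by rewrite scaler0.
have [us|/c0 -> _] := boolP (uniq (map idx s)); last by rewrite scale0r.
by rewrite cardsE (card_uniqP us) size_map eqxx.
Qed.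

Lemma interp_degree k l (S : {set 'I_7}) : all (fun p => size p.2 == k) l ->
  #|S| != k -> interp l S = 0.
Proof.
move=> /allP lk Sk; rewrite /Defs.e /interp sum_ffunE big_seq big1 // => p /lk /eqP pk.
by rewrite !ffunE e_degree ?pk // scaler0.
Qed.

Lemma pull_weight l c m : wf m ->
  all (fun p => \prod_(i <- p.2) nth 0 l i.-1 == c) m ->
  pull (diag_mx (vrow l)) (interp m) = c *: interp m.
Proof.
move=> /allP wfm /allP mc; rewrite /interp linear_sum scaler_sumr big_seq [RHS]big_seq.
apply: eq_bigr => p pm; rewrite linearZ /= pull_diag scalerA [RHS]scalerA mulrC.
congr (_ * _ *: _); have /eqP <- := mc _ pm.
have /allP p7 := wfm _ pm.
by rewrite big_seq [RHS]big_seq; apply: eq_bigr => i /p7 i7; rewrite vrow_idx.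
Qed.

Definition weightL (w : seq int) (l : lform) : lform :=
  [seq (p.1 * \sum_(i <- p.2) nth 0 w i.-1, p.2) | p <- l].

Lemma lie_weight (w : seq int) l :
  all (fun p => sorted ltn p.2 && all in7 p.2) l ->
  lie_derivative (diag_mx (vrow [seq x%:~R | x <- w])) (interp l) =
  interp (weightL w l).
Proof.
move=> /allP lw; rewrite lie_derivative_diag; apply/ffunP => S; rewrite !ffunE.
rewrite /interp big_map !sum_ffunE mulr_sumr big_seq [RHS]big_seq.
apply: eq_bigr => p /lw /andP[ps p7]; rewrite !ffunE e_eset // ffunE.
case: eqP => [->|_]; last by rewrite !scaler0 mulr0.
rewrite ![_ *: 1]mulr1 mulrC intrM; congr (_ * _).
have up : uniq (map idx p.2).
  rewrite map_inj_in_uniq; first by rewrite (sorted_uniq ltn_trans ltnn).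
  move=> i j /(allP p7) i7 /(allP p7) j7 /eqP.
  by rewrite idx_eq // => /eqP.
rewrite (eq_bigl (mem (map idx p.2))) => [|k]; last by rewrite !inE mem_idx.
rewrite -big_uniq //= big_map raddf_sum big_seq [RHS]big_seq.
apply: eq_bigr => i /(allP p7) i7; rewrite vrow_idx //.
have [iw|iw] := ltnP i.-1 (size w); first by rewrite (nth_map 0).
by rewrite !nth_default // size_map.
Qed.

Definition phiL : lform := [:: (1, [:: 1; 6; 7]%N); (1, [:: 2; 5; 7]%N);
  (1, [:: 3; 4; 7]%N); (1, [:: 1; 3; 5]%N); (-1, [:: 1; 2; 4]%N);
  (-1, [:: 2; 3; 6]%N); (-1, [:: 4; 5; 6]%N)].
Definition phi_stdL : lform := [:: (1, [:: 1; 2; 3]%N); (1, [:: 1; 4; 5]%N);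
  (1, [:: 1; 6; 7]%N); (1, [:: 2; 4; 6]%N); (-1, [:: 2; 5; 7]%N);
  (-1, [:: 3; 4; 7]%N); (-1, [:: 3; 5; 6]%N)].
(** The flow scales these two parts of phi by inverse factors, and fixes [psiA] while
    scaling [psiB]. *)
Definition phiA : lform := [:: (1, [:: 1; 6; 7]%N); (1, [:: 2; 5; 7]%N);
  (1, [:: 3; 4; 7]%N); (1, [:: 1; 3; 5]%N); (-1, [:: 4; 5; 6]%N)].
Definition phiB : lform := [:: (-1, [:: 1; 2; 4]%N); (-1, [:: 2; 3; 6]%N)].
Definition psiA : lform := [:: (1, [:: 1; 2; 5; 6]%N); (1, [:: 1; 3; 4; 6]%N);
  (1, [:: 2; 3; 4; 5]%N); (1, [:: 1; 2; 3; 7]%N); (-1, [:: 2; 4; 6; 7]%N)].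
Definition psiB : lform := [:: (1, [:: 1; 4; 5; 7]%N); (1, [:: 3; 5; 6; 7]%N)].

Lemma phiE : interp phiL = e [:: 1; 6; 7]%N + e [:: 2; 5; 7]%N + e [:: 3; 4; 7]%N
    + e [:: 1; 3; 5]%N - e [:: 1; 2; 4]%N - e [:: 2; 3; 6]%N - e [:: 4; 5; 6]%N.
Proof.
by rewrite !interp_cons interp_nil /= !mulrN1z !scale1r !scaleN1r addr0 !addrA.
Qed.

Lemma phi_stdE : interp phi_stdL = phi_std.
Proof.
by rewrite !interp_cons interp_nil /= !mulrN1z !scale1r !scaleN1r addr0 !addrA.
Qed.

Lemma psiBE : interp psiB = e [:: 1; 4; 5; 7]%N + e [:: 3; 5; 6; 7]%N.
Proof. by rewrite !interp_cons interp_nil /= !scale1r addr0. Qed.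

Lemma psiABE (c : R) : interp psiA + c *: interp psiB =
  e [:: 1; 2; 5; 6]%N + e [:: 1; 3; 4; 6]%N + e [:: 2; 3; 4; 5]%N + e [:: 1; 2; 3; 7]%N
  + c *: (e [:: 1; 4; 5; 7]%N + e [:: 3; 5; 6; 7]%N) - e [:: 2; 4; 6; 7]%N.
Proof.
rewrite psiBE !interp_cons interp_nil /= !mulrN1z !scale1r !scaleN1r addr0 !addrA.
by rewrite [LHS]addrAC.
Qed.

Lemma hodge_phi : hodge 1%:M (interp phiL) = interp (psiA ++ psiB).
Proof. by rewrite hodgeLP //; apply: eqLP; vm_compute. Qed.

Lemma hodge_psi : hodge 1%:M (interp (psiA ++ psiB)) = interp phiL.
Proof. by rewrite hodgeLP //; apply: eqLP; vm_compute. Qed.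

Lemma euclidean_phi : euclidean (interp phiL).
Proof. by apply: euclideanLP => //; vm_compute. Qed.

(** The signed permutation e^2 -> - e^2, e^3 <-> e^4 has determinant 1 and takes the
    model form to phi. *)
Definition std_sign (i : nat) : int := if i == 2%N then -1 else 1.
Definition std_swap (i : nat) : nat := if i == 3%N then 4%N else if i == 4%N then 3%N else i.
Definition std_to_phi : 'M[R]_7 :=
  \matrix_(j, k) ((std_sign k.+1)%:~R * (j == idx (std_swap k.+1))%:R).

Lemma pull_std_cov i : in7 i ->
  pull std_to_phi (cov (idx i)) = (std_sign i)%:~R *: cov (idx (std_swap i)).
Proof.
case: i => // i i7; rewrite pull_cov -oneform_cov /oneform scaler_sumr.
by apply: eq_bigr => j _; rewrite mxE scalerA /= !inordK.
Qed.

Definition pull_stdL (l : lform) : lform :=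
  [seq (p.1 * \prod_(i <- p.2) std_sign i, map std_swap p.2) | p <- l].

Lemma pull_stdLP l : wf l -> pull std_to_phi (interp l) = interp (pull_stdL l).
Proof.
move=> /allP wfl; rewrite /interp linear_sum big_map big_seq [RHS]big_seq.
apply: eq_bigr => p /wfl /allP p7; rewrite linearZ /=.
rewrite (@pull_monomial _ _ (fun i => (std_sign i)%:~R) std_swap) => [|i /p7]; last exact: pull_std_cov.
by rewrite scalerA intrM rmorph_prod.
Qed.

Lemma phi_in_std_orbit : interp phiL = pull std_to_phi phi_std.
Proof.
rewrite -phi_stdE pull_stdLP //; apply: eqLP.
rewrite /pull_stdL /= !big_cons !big_nil; by vm_compute.
Qed.

Lemma det_std_to_phi : \det std_to_phi = 1.
Proof.
have := pull_top std_to_phi; rewrite -e_full.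
have fullE : e full = interp [:: (1, full)].
  by rewrite interp_cons interp_nil scale1r addr0.
rewrite {1}fullE pull_stdLP // (_ : interp (pull_stdL _) = e full); last first.
  rewrite fullE; apply: eqLP; rewrite /pull_stdL /= !big_cons !big_nil; by vm_compute.
rewrite e_full => /ffunP/(_ finset.setT); rewrite !ffunE eqxx.
by rewrite [RHS]mulr1.
Qed.

(** With q = e^(s(t)) one has q^4 = 1 - 4 t and f(t) = diag(q^2, q^4, q^2, q^2, 1,
    q^2, 1), and the matrix below is q^2 f(t)^-1.  On 4-forms the factor q^2 becomes
    q^8 = c(t), so that psi_t is the pullback of psi by this matrix. *)
Definition flow_mx (q : R) : 'M[R]_7 :=
  diag_mx (vrow [:: 1; q ^- 2; 1; 1; q ^+ 2; 1; q ^+ 2]).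

Lemma det_flow_mx q : 0 < q -> 0 < \det (flow_mx q).
Proof.
move=> q0; rewrite det_diag prodr_gt0 // => i _; rewrite mxE.
by case: i => [[|[|[|[|[|[|[|i]]]]]]] lt_i7] //=; rewrite ?ltr01 ?invr_gt0 ?exprn_gt0.
Qed.

(** Compares the weight of each monomial of a list with a given one. *)
Ltac weights_by_field :=
  rewrite /= !big_cons !big_nil /=;
  repeat (apply/andP; split=> //); apply/eqP; field.

Lemma pull_flow_psi q : 0 < q ->
  pull (flow_mx q) (interp (psiA ++ psiB)) = interp psiA + q ^+ 4 *: interp psiB.
Proof.
move=> /lt0r_neq0 q0; rewrite interp_cat linearD /= /flow_mx; congr (_ + _).
  by rewrite (@pull_weight _ 1) ?scale1r //; weights_by_field.
by rewrite (@pull_weight _ (q ^+ 4)) //; weights_by_field.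
Qed.

Lemma pull_flow_phi q : 0 < q ->
  pull (flow_mx q) (interp phiL) = q ^+ 2 *: interp phiA + q ^- 2 *: interp phiB.
Proof.
move=> /lt0r_neq0 q0; have -> : interp phiL = interp (phiA ++ phiB).
  by apply: eqLP; vm_compute.
rewrite interp_cat linearD /= /flow_mx; congr (_ + _).
  by rewrite (@pull_weight _ (q ^+ 2)) //; weights_by_field.
by rewrite (@pull_weight _ (q ^- 2)) //; weights_by_field.
Qed.

(** The form is closed, and its star is q^2 phiA + q^-2 phiB.  Here d phiA = 0,
    and d phiB = -2 (e^2467 + e^1237) is fixed by [flow_mx q], so its star is the
    Euclidean one pulled back, q^2 times 2 (e^135 + e^456).  The powers of q cancel
    and the last differential gives 4 psiB. *)
Lemma Delta_flow q : 0 < q ->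
  Delta bracket (interp psiA + q ^+ 4 *: interp psiB)
    (interp psiA + q ^+ 4 *: interp psiB) = 4 *: interp psiB.
Proof.
set a := _ + _ => q_gt0; have q0 : q != 0 by rewrite gt_eqF.
have detN := det_flow_mx q_gt0; set N := flow_mx q in detN.
have aE : a = pull N (interp (psiA ++ psiB)) by rewrite pull_flow_psi.
have gE : metric_of (G2_of a) = N *m N^T.
  rewrite aE -hodge_phi (@G2_of_pull _ _ std_to_phi) //; first exact: metric_pull euclidean_phi _.
  - exact: euclidean_phi.
  - by rewrite hodge_phi hodge_psi.
  - by rewrite det_std_to_phi ltr01.
  - exact: phi_in_std_orbit.
rewrite /Delta gE.
have dA0 : CE_d bracket a = 0.
  rewrite /a linearD linearZ /= !dLP //.
  have -> : interp (dL psiA) = 0 by rewrite -interp_nil; apply: eqLP; vm_compute.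
  have -> : interp (dL psiB) = 0 by rewrite -interp_nil; apply: eqLP; vm_compute.
  by rewrite scaler0 addr0.
rewrite /laplacian dA0 {2}/codiff (_ : [ffun S => _] = 0); last first.
  by apply/ffunP => S; rewrite !ffunE mulr0.
rewrite !linear0 addr0 /codiff.
have -> : [ffun S : {set 'I_7} => (-1) ^+ (7 * #|S|.+1).+1 * a S] = a.
  apply/ffunP => S; rewrite ffunE; have [->|S4] := eqVneq #|S| 4.
    by rewrite -signr_odd expr0 mul1r.
  rewrite (_ : a S = 0) ?mulr0 // /a !ffunE !(@interp_degree 4) //.
  by rewrite scaler0 addr0.
rewrite {1}aE hodge_pull // hodge_psi pull_flow_phi // linearD !linearZ /= !dLP //.
pose X : lform := [:: (-2, [:: 2; 4; 6; 7]%N); (-2, [:: 1; 2; 3; 7]%N)].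
pose Y : lform := [:: (2, [:: 1; 3; 5]%N); (2, [:: 4; 5; 6]%N)].
have -> : interp (dL phiA) = 0 by rewrite -interp_nil; apply: eqLP; vm_compute.
have -> : interp (dL phiB) = interp X by apply: eqLP; vm_compute.
rewrite scaler0 add0r.
have XE : pull N (interp X) = interp X.
  by rewrite /N (@pull_weight _ 1) ?scale1r //; weights_by_field.
have YE : pull N (interp Y) = q ^+ 2 *: interp Y.
  by rewrite /N (@pull_weight _ (q ^+ 2)) //; weights_by_field.
rewrite -XE linearZ /= hodge_pull // hodgeLP //.
have -> : interp (hodgeL X) = interp Y by apply: eqLP; vm_compute.
rewrite YE scalerA mulVf ?expf_neq0 // scale1r dLP //.
have -> : interp (dL Y) = interp (scaleL 4 psiB) by apply: eqLP; vm_compute.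
by rewrite scaleLP.
Qed.

Lemma flow_dual q : 0 < q ->
  is_dual (interp psiA + q ^+ 4 *: interp psiB) (pull (flow_mx q) (interp phiL)).
Proof.
move=> q0; rewrite -pull_flow_psi // -hodge_phi.
apply/(dual_unique euclidean_phi _ _ phi_in_std_orbit) => //.
- by rewrite hodge_phi hodge_psi.
- by rewrite det_std_to_phi ltr01.
- exact: det_flow_mx.
Qed.

(** [adA] exchanges e_1 with e_6 and e_3 with e_4 and kills the other basis vectors. *)
Lemma diag_adA_comm l : nth 0 l 0 = nth 0 l 5 -> nth 0 l 2 = nth 0 l 3 ->
  diag_mx (vrow l) *m adA = adA *m diag_mx (vrow l).
Proof.
move=> l05 l23; apply/matrixP => i j; rewrite mul_diag_mx mul_mx_diag !mxE.
have [|_] := boolP (_ \in _); last by rewrite mulr0 mul0r.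
rewrite mulr1 mul1r !inE !xpair_eqE !eqSS.
by case/or4P => /andP[/eqP-> /eqP->].
Qed.

Lemma diag_derivation l : nth 0 l 0 = nth 0 l 5 -> nth 0 l 2 = nth 0 l 3 ->
  nth 0 l 6 = 0 -> is_derivation bracket (diag_mx (vrow l)).
Proof.
move=> l05 l23 l6 x y; rewrite /bracket.
have xD7 (z : 'rV[R]_7) : (z *m diag_mx (vrow l)) 0 ord_max = 0.
  by rewrite mul_mx_diag !mxE l6 mulr0.
rewrite !xD7 !scale0r sub0r subr0 mulmxBl -!scalemxAl -!mulmxA diag_adA_comm //.
by rewrite addrC.
Qed.

Lemma d_mono s m : all in7 s -> eqL (dL (mono s)) m ->
  CE_d bracket (e s) = interp m.
Proof.
move=> s7 sm; rewrite -(eqLP sm) -dLP; last by rewrite /wf /= s7.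
by rewrite interp_cons interp_nil scale1r addr0.
Qed.

Lemma interp_mono s : interp (mono s) = e s.
Proof. by rewrite interp_cons interp_nil scale1r addr0. Qed.

Lemma expM_weights (x : R) :
  expM (x *: diag_mx (\row_(i < 7) nth 0 [:: 2; 4; 2; 2; 0; 2; 0] i)) =
  diag_mx (vrow [:: expR x ^+ 2; expR x ^+ 4; expR x ^+ 2; expR x ^+ 2; 1; expR x ^+ 2; 1]).
Proof.
rewrite -linearZ /= expM_diag; congr diag_mx; apply/rowP => i; rewrite !mxE.
by case: i => [[|[|[|[|[|[|[|i]]]]]]] lt_i7] //=; rewrite ?mulr0 ?expR0 // expRM_natr.
Qed.

(** The weights of - Q = 2 - D. *)
Lemma soliton_weights :
  2%:M - diag_mx (\row_(i < 7) nth 0 [:: 2; 4; 2; 2; 0; 2; 0] i) =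
  diag_mx (vrow [seq x%:~R | x <- [:: 0; -2; 0; 0; 2; 0; 2]]) :> 'M[R]_7.
Proof.
rewrite -diag_const_mx -linearB /=; congr diag_mx; apply/rowP => j; rewrite !mxE.
case: j => [[|[|[|[|[|[|[|j]]]]]]] lt_j7] //=; rewrite ?subrr ?subr0 //.
have -> : (-2)%:~R = - 2 :> R by [].
by ring.
Qed.

Lemma invmx_weights (q : R) : q != 0 ->
  let A := diag_mx (vrow [:: q ^+ 2; q ^+ 4; q ^+ 2; q ^+ 2; 1; q ^+ 2; 1]) in
  A \in unitmx /\
  invmx A = diag_mx (vrow [:: q ^- 2; q ^- 4; q ^- 2; q ^- 2; 1; q ^- 2; 1]).
Proof.
move=> q0 A; set B := diag_mx _.
have AB : A *m B = 1%:M.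
  rewrite mulmx_diag -diag_const_mx; congr diag_mx; apply/rowP => i; rewrite !mxE.
  by case: i => [[|[|[|[|[|[|[|i]]]]]]] lt_i7] //=; rewrite ?mulr1 ?divff ?expf_neq0.
have [uA _] := mulmx1_unit AB; split=> //.
by rewrite -[LHS]mulmx1 -AB mulKmx.
Qed.

Lemma pull_inverse_weights (q : R) : q != 0 ->
  pull (diag_mx (vrow [:: q ^- 2; q ^- 4; q ^- 2; q ^- 2; 1; q ^- 2; 1]))
    (interp (psiA ++ psiB)) = q ^- 8 *: interp psiA + q ^- 4 *: interp psiB.
Proof.
move=> q0; rewrite interp_cat linearD /=; congr (_ + _).
  by rewrite (@pull_weight _ (q ^- 8)) //; weights_by_field.
by rewrite (@pull_weight _ (q ^- 4)) //; weights_by_field.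
Qed.

(** The formula for F holds on a neighbourhood of t, which is all that the derivative
    sees. *)
Lemma affine_form_derive (a b : extform R 7) (F : R -> extform R 7) (t t0 : R) :
  t < t0 -> (forall u, u < t0 -> F u = a + (1 - 4 * u) *: b) ->
  form_is_derive F t (- (4 *: b)).
Proof.
move=> tt0 FE S.
apply: (@near_eq_is_derive R R^o R^o (fun u : R => a S + (1 - 4 * u) * b S : R^o)).
  near=> u; rewrite FE ?ffunE //.
  near: u; exact: lt_nbhsl.
have -> : (fun u => a S + (1 - 4 * u) * b S) =
    cst (a S + b S) + ((- 4 * b S) \*: id) :> (R -> R^o).
  by apply/funext => u; rewrite /= -[RHS]/(a S + b S + (- 4 * b S) * u); ring.
have := is_deriveD (is_derive_cst (a S + b S : R^o) t 1)
  (is_deriveZ (-4 * b S) (is_derive_id (t : R^o) 1)).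
by rewrite add0r !ffunE [_ *: 1]mulr1 mulNr.
Unshelve. all: by end_near.
Qed.

End Example.

Theorem mainTheorem1 (R : realType) :
  let d : extform R 7 -> extform R 7 := CE_d bracket in
  let phi : extform R 7 :=
    e [:: 1; 6; 7]%N + e [:: 2; 5; 7]%N + e [:: 3; 4; 7]%N + e [:: 1; 3; 5]%N
    - e [:: 1; 2; 4]%N - e [:: 2; 3; 6]%N - e [:: 4; 5; 6]%N in
  let psi : extform R 7 := star phi phi in
  let D : 'M[R]_7 :=
    diag_mx (\row_(i < 7) nth 0 [:: 2; 4; 2; 2; 0; 2; 0] i) in
  let lambda : R := - 8 in
  let Q : 'M[R]_7 := D + (lambda / 4)%:M in
  let c (t : R) : R := (1 - 4 * t) ^+ 2 in
  let s (t : R) : R := 4^-1 * ln (1 - 4 * t) in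
  let f (t : R) : 'M[R]_7 := expM (s t *: D) in
  let psi_ (t : R) : extform R 7 := c t *: pull (invmx (f t)) psi in
  let I : set R := [set t | t < 4^-1]%classic in
  (* the structure equations, and phi with its metric and dual 4-form *)
  ([/\ d (e [:: 1]%N) = e [:: 6; 7]%N, d (e [:: 6]%N) = e [:: 1; 7]%N,
       d (e [:: 3]%N) = e [:: 4; 7]%N, d (e [:: 4]%N) = e [:: 3; 7]%N
     & [/\ d (e [:: 2]%N) = 0, d (e [:: 5]%N) = 0 & d (e [:: 7]%N) = 0]] /\
   [/\ is_positive phi, metric_of phi = 1%:M
     & psi = e [:: 1; 2; 5; 6]%N + e [:: 1; 3; 4; 6]%N + e [:: 2; 3; 4; 5]%N
             + e [:: 1; 2; 3; 7]%N + e [:: 1; 4; 5; 7]%N + e [:: 3; 5; 6; 7]%N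
             - e [:: 2; 4; 6; 7]%N]) /\
  (* (1) *)
  (d psi = 0 /\
   Delta bracket psi psi = 4 *: (e [:: 1; 4; 5; 7]%N + e [:: 3; 5; 6; 7]%N)) /\
  (* (2) *)
  [/\ is_derivation bracket D,
      - Delta bracket psi psi = lie_derivative D psi + lambda *: psi,
      Q = D - 2%:M
    & Delta bracket psi psi = theta Q psi] /\
  (* (3) *)
  [/\ forall t, t < 4^-1 ->
        psi_ t = e [:: 1; 2; 5; 6]%N + e [:: 1; 3; 4; 6]%N
                 + e [:: 2; 3; 4; 5]%N + e [:: 1; 2; 3; 7]%N
                 + (1 - 4 * t) *: (e [:: 1; 4; 5; 7]%N + e [:: 3; 5; 6; 7]%N)
                 - e [:: 2; 4; 6; 7]%N,
      psi_ 0 = psi,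
      coflow_solution bracket I psi_,
      self_similar I psi psi_
    & forall t, t < 4^-1 ->
        form_is_derive psi_ t
          (- (4 *: (e [:: 1; 4; 5; 7]%N + e [:: 3; 5; 6; 7]%N))) /\
        - (4 *: (e [:: 1; 4; 5; 7]%N + e [:: 3; 5; 6; 7]%N)) =
        - Delta bracket (psi_ t) (psi_ t)].
Proof.
move=> d phi psi D lambda Q c s f psi_ I.
have phi_interp : phi = interp phiL by rewrite phiE.
have star1 : star phi phi = hodge 1%:M phi.
  have := @star_pull R phi 1%:M; rewrite !pull_id det1 ltr01 => -> //.
  by rewrite phi_interp; exact: euclidean_phi.
have psiE : psi = interp (psiA ++ psiB) by rewrite /psi star1 phi_interp hodge_phi.
have psiE1 : psi = interp psiA + 1 *: interp psiB by rewrite psiE interp_cat scale1r.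
have DeltaE : Delta bracket psi psi = 4 *: interp psiB.
  by have := Delta_flow (@ltr01 R); rewrite expr1n -psiE1.
have DE : D = diag_mx (vrow [seq x%:~R | x <- [:: 2; 4; 2; 2; 0; 2; 0]]) by [].
have Q2 : Q = D - 2%:M.
  by rewrite /Q -raddfN; congr (D + _%:M); rewrite /lambda; field.
have QE : - Q = diag_mx (vrow [seq x%:~R | x <- [:: 0; -2; 0; 0; 2; 0; 2]]).
  by rewrite Q2 opprB soliton_weights.
have q4 t : t < 4^-1 -> expR (s t) ^+ 4 = 1 - 4 * t.
  move=> t4; rewrite -expRM_natl /s mulrA divff ?mul1r ?pnatr_eq0 // lnK //.
  by rewrite posrE; lra.
have q0 t : expR (s t) != 0 by rewrite gt_eqF ?expR_gt0.
have fE t : f t = diag_mx (vrow [:: expR (s t) ^+ 2; expR (s t) ^+ 4; expR (s t) ^+ 2;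
    expR (s t) ^+ 2; 1; expR (s t) ^+ 2; 1]) by exact: expM_weights.
have psi_E t : t < 4^-1 -> psi_ t = interp psiA + (1 - 4 * t) *: interp psiB.
  move=> t4; rewrite /psi_ fE (invmx_weights (q0 t)).2 psiE pull_inverse_weights //.
  rewrite /c -(q4 t t4) scalerDr !scalerA; congr (_ + _ *: _); last by field.
  by rewrite -[RHS]scale1r; congr (_ *: _); field.
have psi_E4 t : t < 4^-1 -> psi_ t = interp psiA + expR (s t) ^+ 4 *: interp psiB.
  by move=> t4; rewrite q4 // psi_E.
have Delta_t t : t < 4^-1 -> Delta bracket (psi_ t) (psi_ t) = 4 *: interp psiB.
  by move=> t4; rewrite (psi_E4 t t4); exact: Delta_flow (expR_gt0 (s t)).
have derive_t t : t < 4^-1 -> form_is_derive psi_ t (- (4 *: interp psiB)).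
  by move=> t4; exact: affine_form_derive t4 psi_E.
have lt04 : (0 : R) < 4^-1 by rewrite invr_gt0 ltr0n.
split; first split.
- have dE a b : all in7 a -> eqL (dL (mono a)) (mono b) -> d (e a) = e b.
    by move=> a7 ab; rewrite /d (d_mono a7 ab) interp_mono.
  have d0 a : all in7 a -> eqL (dL (mono a)) [::] -> d (e a) = 0.
    by move=> a7 a0; rewrite /d (d_mono a7 a0) interp_nil.
  split; [exact: dE|exact: dE|exact: dE|exact: dE|split; exact: d0].
- split.
  + exists std_to_phi; rewrite det_std_to_phi ltr01; split=> //.
    by rewrite phi_interp phi_in_std_orbit.
  + have := @metric_pull R phi 1%:M; rewrite pull_id det1 ltr01 trmx1 mulmx1 => -> //.
    by rewrite phi_interp; exact: euclidean_phi.
  + by rewrite psiE1 psiABE scale1r !addrA.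
split.
  split; last by rewrite DeltaE psiBE.
  rewrite psiE /d dLP // -interp_nil; apply: eqLP; by vm_compute.
split.
  split=> //.
  - by rewrite DE; exact: diag_derivation.
  - rewrite DeltaE DE psiE lie_weight // /lambda -scaleNr.
    have -> : - (8 : R) = (- 8)%:~R by [].
    have -> : - (4 : R) = (- 4)%:~R by [].
    rewrite -!scaleLP -interp_cat; apply: eqLP.
    rewrite /weightL /= !big_cons !big_nil; by vm_compute.
  - rewrite DeltaE thetaE QE psiE lie_weight //.
    have -> : (4 : R) = (4 : int)%:~R by [].
    rewrite -scaleLP; apply: eqLP.
    rewrite /weightL /= !big_cons !big_nil; by vm_compute.
split.
- by move=> t t4; rewrite psi_E // psiABE.
- by rewrite psi_E // mulr0 subr0 psiE1.
- move=> t t4; split; last by rewrite Delta_t //; exact: derive_t.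
  exists (pull (flow_mx (expR (s t))) (interp phiL)).
  by rewrite (psi_E4 t t4); exact: flow_dual (expR_gt0 (s t)).
- exists c, (fun t p => p *m invmx (f t)) => t t4.
  have [uf fV] := invmx_weights (q0 t).
  split.
  + by rewrite expf_neq0 // gt_eqF // subr_gt0; move: t4; rewrite /I /=; lra.
  + by apply: linear_diffeomorphism; rewrite unitmx_inv fE.
  + move=> p; rewrite fE fV pull_form_automorphism ?diag_adA_comm ?mxE //.
    by rewrite !left_invariant_formE -linearZ /= /psi_ fE fV.
- move=> t t4; rewrite -psiBE; split; first exact: derive_t.
  by rewrite Delta_t.
Qed.
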